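(* Let $\bar A\in\{0,\star\}^{n\times n}$ and $\bar B\in\{0,\star\}^{n\times p}$ be structural matrices, and suppose that the state bipartite graph $\mathcal B(\bar A)$ has a perfect matching. Let $\mathcal N^1,\ldots,\mathcal N^k$ be the non-top linked strongly connected components of the state digraph $\mathcal D(\bar A)$. Then the minCIS problem with instance $(\bar A,\bar B)$ can be polynomially reduced to the minimum set covering problem with universe $\mathcal U=\{1,\ldots,k\}$ and sets $\{\mathcal S_j\}_{j=1,\ldots,p}$, where $$\mathcal S_j=\{i\in\mathcal U:\ \bar B_{r,j}=\star\text{ for some }r\text{ such that }x_r\text{ is a vertex of }\mathcal N^i\}.$$ That is, $\mathcal U$ and $\{\mathcal S_j\}_{j=1,\ldots,p}$ can be computed from $(\bar A,\bar B)$ in a number of operations polynomial in the size of $\bar A$ and $\bar B$, and every solution $\mathcal J^*\subseteq\{1,\ldots,p\}$ of this minimum set covering problem is a solution of the minCIS problem with instance $(\bar A,\bar B)$.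
   Context: A structural matrix is a matrix with entries in $\{0,\star\}$, where $0$ denotes a fixed zero and $\star$ a free parameter. A numerical realization of a structural matrix $\bar M\in\{0,\star\}^{a\times b}$ is a real matrix $M\in\mathbb R^{a\times b}$ with $M_{i,j}=0$ whenever $\bar M_{i,j}=0$ (the entries at $\star$ positions are arbitrary real numbers). A pair $(\bar A,\bar B)$ with $\bar A\in\{0,\star\}^{n\times n}$, $\bar B\in\{0,\star\}^{n\times p}$ is structurally controllable if there exist numerical realizations $A$ of $\bar A$ and $B$ of $\bar B$ such that the linear time-invariant system $\dot x(t)=Ax(t)+Bu(t)$ is controllable. For $\mathcal J\subseteq\{1,\ldots,p\}$, $\bar B(\mathcal J)$ denotes the submatrix of $\bar B$ formed by the columns with index in $\mathcal J$. minCIS problem with instance $(\bar A,\bar B)$: find $\mathcal J\subseteq\{1,\ldots,p\}$ of minimum cardinality such that $(\bar A,\bar B(\mathcal J))$ is structurally controllable. Minimum set covering problem with universe $\mathcal U$ and sets $\mathcal S_1,\ldots,\mathcal S_p\subseteq\mathcal U$: find $\mathcal I\subseteq\{1,\ldots,p\}$ of minimum cardinality such that $\bigcup_{i\in\mathcal I}\mathcal S_i=\mathcal U$. State digraph $\mathcal D(\bar A)$: the directed graph with vertex set $\mathcal X=\{x_1,\ldots,x_n\}$ and edge set $\mathcal E_{\mathcal X,\mathcal X}=\{(x_i,x_j):\bar A_{j,i}\neq0\}$ (self-loops allowed). A strongly connected component (SCC) of $\mathcal D(\bar A)$ is non-top linked if no edge of $\mathcal D(\bar A)$ goes from a vertex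 of another SCC to a vertex of it. State bipartite graph $\mathcal B(\bar A)$: the bipartite graph whose left and right vertex sets are two copies of $\mathcal X$, with an edge from left vertex $x_i$ to right vertex $x_j$ exactly when $(x_i,x_j)\in\mathcal E_{\mathcal X,\mathcal X}$. A matching is a set of edges no two of which share a left vertex or share a right vertex; it is perfect if every left vertex and every right vertex is incident to one of its edges. *)

(* Defs.v *)
From mathcomp Require Import all_boot all_order all_algebra.
From mathcomp Require Import all_classical all_reals all_analysis.

Set Implicit Arguments.
Unset Strict Implicit.
Unset Printing Implicit Defensive.

Import Order.TTheory GRing.Theory Num.Theory numFieldNormedType.Exports.

Local Open Scope classical_set_scope.
Local Open Scope ring_scope.

(* A structural matrix is a boolean matrix: [true] is the free parameter
   (star) and [false] the fixed zero. *)
Definition smatrix (a b : nat) : Type := 'M[bool]_(a, b).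

Definition realization (R : realType) (a b : nat)
    (Mbar : smatrix a b) (M : 'M[R]_(a, b)) : Prop :=
  forall i j, Mbar i j = false -> M i j = 0.

(* Controllability of x' = A x + B u: every state can be steered to every
   other one in some finite time by some continuous input. *)
Definition controllable (R : realType) (n m : nat)
    (A : 'M[R]_(n, n)) (B : 'M[R]_(n, m)) : Prop :=
  forall x0 x1 : 'cV[R]_n, exists T : R, 0 < T /\
  exists (u : R -> 'cV[R]_m) (x : R -> 'cV[R]_n),
    [/\ {within `[0, T], continuous u},
        {within `[0, T], continuous x},
        forall t : R, 0 < t < T -> is_derive t 1 x (A *m x t + B *m u t),
        x 0 = x0 & x T = x1].

Definition structurally_controllable (R : realType) (n m : nat)
    (Abar : smatrix n n) (Bbar : smatrix n m) : Prop :=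
  exists (A : 'M[R]_(n, n)) (B : 'M[R]_(n, m)),
    [/\ realization Abar A, realization Bbar B & controllable A B].

Definition subcolumns (n p : nat) (B : smatrix n p) (J : {set 'I_p}) :
    smatrix n #|J| :=
  colsub (fun j : 'I_#|J| => enum_val j) B.

Definition min_card_solution (p : nat) (P : {set 'I_p} -> Prop)
    (J : {set 'I_p}) : Prop :=
  P J /\ forall J' : {set 'I_p}, P J' -> (#|J| <= #|J'|)%N.

Definition minCIS_solution (R : realType) (n p : nat)
    (A : smatrix n n) (B : smatrix n p) : {set 'I_p} -> Prop :=
  min_card_solution (fun J => structurally_controllable R A (subcolumns B J)).

Definition min_set_cover_solution (k p : nat) (S : 'I_p -> {set 'I_k}) :
    {set 'I_p} -> Prop :=
  min_card_solution (fun I => (\bigcup_(i in I) S i)%SET = [set: 'I_k]%SET).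

Definition state_edge (n : nat) (A : smatrix n n) : rel 'I_n :=
  fun i j => A j i.

Definition sccs (n : nat) (A : smatrix n n) : {set {set 'I_n}} :=
  equivalence_partition
    [rel i j | connect (state_edge A) i j && connect (state_edge A) j i]
    [set: 'I_n]%SET.

Definition non_top_linked (n : nat) (A : smatrix n n) (C : {set 'I_n}) : Prop :=
  forall C' : {set 'I_n}, C' \in sccs A -> C' != C ->
  forall i j : 'I_n, i \in C' -> j \in C -> ~~ state_edge A i j.

(* [N] lists the non-top linked SCCs, each exactly once, in some order. *)
Definition non_top_linked_sccs (n : nat) (A : smatrix n n)
    (k : nat) (N : 'I_k -> {set 'I_n}) : Prop :=
  injective N /\
  forall C : {set 'I_n},
    (C \in sccs A /\ non_top_linked A C) <-> exists i, N i = C.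

(* A pair (i, j) stands for the edge from left vertex i to right vertex j. *)
Definition bipartite_matching (n : nat) (A : smatrix n n)
    (M : {set 'I_n * 'I_n}) : Prop :=
  [/\ {in M, forall e, state_edge A e.1 e.2},
      {in M &, injective (fun e : 'I_n * 'I_n => e.1)} &
      {in M &, injective (fun e : 'I_n * 'I_n => e.2)}].

Definition has_perfect_matching (n : nat) (A : smatrix n n) : Prop :=
  exists M : {set 'I_n * 'I_n},
    [/\ bipartite_matching A M,
        forall i : 'I_n, exists2 e, e \in M & e.1 = i &
        forall j : 'I_n, exists2 e, e \in M & e.2 = j].

Definition cover_sets (n p k : nat) (B : smatrix n p)
    (N : 'I_k -> {set 'I_n}) (j : 'I_p) : {set 'I_k} :=
  [set i : 'I_k | [exists r : 'I_n, (r \in N i) && B r j]]%SET.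

Local Open Scope nat_scope.

(* Model of computation: structured programs over a random-access memory of
   natural numbers.  A cell is addressed by three numbers, a constant array
   name and two computed indices.  Every operator, memory access and branching
   counts for one operation; there is no multiplication, so that each
   operation lengthens the numbers in play by at most one bit and unit cost is
   polynomially related to Turing machine time. *)
Definition store : Type := nat -> nat -> nat -> nat.

Inductive expr : Type :=
| Const of nat
| Get of nat & expr & expr
| Plus of expr & expr
| Minus of expr & expr. (* truncated at 0 *)

Inductive cmd : Type :=
| Skip
| Put of nat & expr & expr & expr (* array, indices, value *)
| Seq of cmd & cmd
| IfNZ of expr & cmd & cmd
| WhileNZ of expr & cmd.

Fixpoint eval (s : store) (e : expr) : nat :=
  match e with
  | Const c => c
  | Get a e1 e2 => s a (eval s e1) (eval s e2)
  | Plus e1 e2 => eval s e1 + eval s e2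
  | Minus e1 e2 => eval s e1 - eval s e2
  end.

Fixpoint ecost (e : expr) : nat :=
  match e with
  | Const _ => 1
  | Get _ e1 e2 | Plus e1 e2 | Minus e1 e2 => (ecost e1 + ecost e2).+1
  end.

Definition update (s : store) (a i j v : nat) : store :=
  fun a' i' j' =>
    if [&& a' == a, i' == i & j' == j] then v else s a' i' j'.

(* [exec c s t s']: run from [s], [c] halts in [s'] after [t] operations. *)
Inductive exec : cmd -> store -> nat -> store -> Prop :=
| ExecSkip s : exec Skip s 1 s
| ExecPut s a e1 e2 e :
    exec (Put a e1 e2 e) s (ecost e1 + ecost e2 + ecost e).+1
      (update s a (eval s e1) (eval s e2) (eval s e))
| ExecSeq c1 c2 s1 s2 s3 t1 t2 :
    exec c1 s1 t1 s2 -> exec c2 s2 t2 s3 ->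
    exec (Seq c1 c2) s1 (t1 + t2) s3
| ExecIfTrue e c1 c2 s s' t :
    eval s e != 0 -> exec c1 s t s' ->
    exec (IfNZ e c1 c2) s (ecost e + t).+1 s'
| ExecIfFalse e c1 c2 s s' t :
    eval s e = 0 -> exec c2 s t s' ->
    exec (IfNZ e c1 c2) s (ecost e + t).+1 s'
| ExecWhileTrue e c s1 s2 s3 t1 t2 :
    eval s1 e != 0 -> exec c s1 t1 s2 -> exec (WhileNZ e c) s2 t2 s3 ->
    exec (WhileNZ e c) s1 (ecost e + t1 + t2).+1 s3
| ExecWhileFalse e c s :
    eval s e = 0 -> exec (WhileNZ e c) s (ecost e).+1 s.

Definition entry (a b : nat) (M : smatrix a b) (i j : nat) : nat :=
  match insub i : option 'I_a, insub j : option 'I_b with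
  | Some i', Some j' => nat_of_bool (M i' j')
  | _, _ => 0
  end.

(* Input: n and p in cells (0,0,0) and (0,0,1), the entries of A and B in
   arrays 1 and 2, zero everywhere else. *)
Definition input_store (n p : nat) (A : smatrix n n) (B : smatrix n p) : store :=
  fun a i j =>
    match a, i, j with
    | 0, 0, 0 => n
    | 0, 0, 1 => p
    | 1, _, _ => entry A i j
    | 2, _, _ => entry B i j
    | _, _, _ => 0
    end.

(* Output: k in cell (3,0,0) and, in array 4, the k x p incidence table of
   the sets S_j. *)
Definition output_is (k p : nat) (S : 'I_p -> {set 'I_k}) (s : store) : Prop :=
  s 3 0 0 = k /\
  forall (i : 'I_k) (j : 'I_p), s 4 i j = nat_of_bool (i \in S j).

Definition input_size (n p : nat) : nat := n * n + n * p.

Definition computes_within (c : cmd) (time : nat) (n p : nat)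
    (A : smatrix n n) (B : smatrix n p) (k : nat) (S : 'I_p -> {set 'I_k}) :
    Prop :=
  exists t s', [/\ exec c (input_store A B) t s', t <= time & output_is S s'].

(* Main.v *)
Require Import Defs.
From mathcomp Require Import all_boot all_order all_fingroup all_algebra.
From mathcomp Require Import all_classical all_reals all_analysis.
From mathcomp Require Import complex spectral ring lra zify.

(* An index set J covers the non-top linked SCCs exactly when (A, B(J)) is
   structurally controllable, so the two problems have the same feasible sets.

   If a non-top linked SCC meets no chosen column, then in every realization its
   states obey an autonomous linear equation, and a Gronwall estimate shows that
   they cannot leave 0.  Conversely, a perfect matching is a permutation whose
   cycles partition the states, and if J covers, these cycles form a forest of
   breadth-first search trees rooted at the inputs.  Give the edges of each cycle
   one common weight, distinct cycles having distinct positive integer weights,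
   and weight 1 to the tree edges.  If a left eigenvector v is killed by B, then
   the cycles on which v does not vanish are all ancestors of a single cycle, the
   only one whose weight has the modulus of the eigenvalue; so no cancellation
   between siblings is possible and v does not vanish on the root, which
   contradicts v B = 0.  The Kalman condition follows, and steering is done by
   polynomial inputs: with the coefficients c_k of the characteristic polynomial,
   x = sum_k A^k B w_k is a trajectory when w_(k-1) = w_k' + c_k w_(n-1), so that
   x is determined by w_(n-1), which is found by Hermite interpolation.

   The program computes reachability by Warshall's algorithm, keeps the least
   vertex of every non-top linked SCC, and emits one row for each. *)

Set Implicit Arguments.
Unset Strict Implicit.
Unset Printing Implicit Defensive.

Import Order.TTheory GRing.Theory Num.Theory numFieldNormedType.Exports.

(** * Running time of programs *)

Local Open Scope nat_scope.

Local Notation eval := Defs.eval.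

(** Bounding the cost from above, instead of giving it exactly, lets all rounds of a loop share one
    bound. *)
Definition runs (c : cmd) (s : store) (b : nat) (s' : store) : Prop :=
  exists2 t, t <= b & exec c s t s'.

Lemma runs_le c s b b' s' : b <= b' -> runs c s b s' -> runs c s b' s'.
Proof. by move=> le [t tb]; exists t => //; apply: leq_trans le. Qed.

Lemma runs_seq c1 c2 s1 s2 s3 b1 b2 :
  runs c1 s1 b1 s2 -> runs c2 s2 b2 s3 -> runs (Seq c1 c2) s1 (b1 + b2) s3.
Proof.
by move=> [t1 l1 e1] [t2 l2 e2]; exists (t1 + t2); [exact: leq_add|exact: ExecSeq e1 e2].
Qed.

Lemma runs_put a e1 e2 e s b : (ecost e1 + ecost e2 + ecost e).+1 <= b ->
  runs (Put a e1 e2 e) s b (update s a (eval s e1) (eval s e2) (eval s e)).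
Proof. by move=> le; eexists; [exact: le|exact: ExecPut]. Qed.

Lemma updateE s a i j v : update s a i j v a i j = v.
Proof. by rewrite /update !eqxx. Qed.

Lemma update_neq s a i j v a' i' j' : [|| a' != a, i' != i | j' != j] ->
  update s a i j v a' i' j' = s a' i' j'.
Proof. by rewrite /update; do 3 case: eqVneq => //=. Qed.

Definition cell (a i j : nat) : expr := Get a (Const i) (Const j).

(* Array 5 holds the loop counters, 6 the reachability relation and 7 its next
   value, 8 marks the skipped vertices, and 9 tells which columns touch the
   ancestors of a vertex. *)
Definition counter (x : nat) : expr := cell 5 x 0.

(* The loop bound is read from cell (0,0,c), so [c] is 0 for n and 1 for p. *)
Definition for_loop (x c : nat) (body : cmd) : cmd :=
  Seq (Put 5 (Const x) (Const 0) (Const 0))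
    (WhileNZ (Minus (cell 0 0 c) (counter x))
      (Seq body (Put 5 (Const x) (Const 0) (Plus (counter x) (Const 1))))).

Lemma runs_for (I : nat -> store -> Prop) (x c : nat) (body : cmd) (b N : nat)
    (s : store) :
  (forall m s, I m s -> s 0 0 c = N /\ s 5 x 0 = m) ->
  (forall m s, m < N -> I m s -> exists s', runs body s b s' /\
     s' 5 x 0 = m /\ I m.+1 (update s' 5 x 0 m.+1)) ->
  I 0 (update s 5 x 0 0) ->
  exists s', runs (for_loop x c body) s (N * (b + 16) + 12) s' /\ I N s'.
Proof.
move=> Icell Istep I0.
pose w := WhileNZ (Minus (cell 0 0 c) (counter x))
  (Seq body (Put 5 (Const x) (Const 0) (Plus (counter x) (Const 1)))).
(* Setting the counter costs 4 and the last, failing test 8. Each round adds to its body 7 for the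
   test, 8 for the increment and 1 for the branching. *)
suff loop d m s1 : d + m = N -> I m s1 ->
    exists s', runs w s1 (d * (b + 16) + 8) s' /\ I N s'.
  have [s' [H1 H2]] := loop N 0 _ (addn0 N) I0.
  exists s'; split=> //; have -> : N * (b + 16) + 12 = 4 + (N * (b + 16) + 8) by lia.
  by apply: runs_seq H1; apply: runs_put.
elim: d m s1 => [|d IHd] m s1 dm Im; have [cN xm] := Icell _ _ Im.
  exists s1; rewrite -dm; split=> //; exists 8 => //.
  by apply: ExecWhileFalse; rewrite /= cN xm -dm subnn.
have mN : m < N by lia.
have [s2 [[t lt et] [s2m I2]]] := Istep _ _ mN Im.
have [|s' [[t' lt' et'] IN]] := IHd m.+1 _ _ I2; first by lia.
exists s'; split=> //; exists (7 + (t + 8) + t').+1; first by lia.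
apply: (@ExecWhileTrue _ _ _ (update s2 5 x 0 m.+1)) et'.
  by rewrite /= cN xm; lia.
apply: ExecSeq et _.
have := ExecPut s2 5 (Const x) (Const 0) (Plus (counter x) (Const 1)).
by rewrite /= s2m [m + 1]addn1.
Qed.

(** Nested loops all keep their counters in array 5, so a loop may change only its own counters [X]
    there. *)
Definition frame (a : nat) (X : seq nat) (s s' : store) : Prop :=
  forall a' i j, (a' != a) && ((a' != 5) || (i \notin X)) -> s' a' i j = s a' i j.

Definition fill_row (a : nat) (er : expr) (x c : nat) (e : expr) : cmd :=
  for_loop x c (Put a er (counter x) e).

(** When [e] is evaluated, the cell about to be written still has its old value; hence [e] may
    accumulate into that cell. *)
Lemma runs_fill_row (a : nat) (er : expr) (x c : nat) (e : expr) (r N : nat)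
    (f : nat -> nat) (s : store) :
  a != 5 -> a != 0 -> s 0 0 c = N ->
  (forall s', frame a [:: x] s s' -> eval s' er = r) ->
  (forall s' j, j < N -> frame a [:: x] s s' -> s' 5 x 0 = j -> s' a r j = s a r j ->
     eval s' e = f j) ->
  exists s', [/\ runs (fill_row a er x c e) s (N * (ecost er + ecost e + 20) + 12) s',
    frame a [:: x] s s' &
    forall i j, s' a i j = if (i == r) && (j < N) then f j else s a i j].
Proof.
move=> a5 a0 sN erP eP.
pose I m s' := [/\ s' 5 x 0 = m, frame a [:: x] s s' &
   forall i j, s' a i j = if (i == r) && (j < m) then f j else s a i j].
have [||| s' [Rs' [_ F V]]] := @runs_for I x c (Put a er (counter x) e)
    (ecost er + ecost e + 4) N s.
- by move=> m s' [xm F _]; rewrite F ?sN // eq_sym a0.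
- move=> m s1 mN [xm F V]; eexists; split; first by apply: runs_put => /=; lia.
  have er1 := erP s1 F.
  have e1 : eval s1 e = f m by apply: eP => //; rewrite V ltnn andbF.
  rewrite er1 e1 /= xm; split; first by rewrite update_neq ?xm // eq_sym a5.
  split; first by rewrite updateE.
    move=> a' i j /[dup] H /andP[a'a a'5]; rewrite !update_neq ?a'a ?F //.
    by move: a'5; rewrite inE; case: eqP => //= _ ->.
  move=> i j; rewrite update_neq ?a5 //.
  have [->|ir] /= := eqVneq i r; last by rewrite update_neq ?ir ?orbT // V (negbTE ir).
  have [->|jm] /= := eqVneq j m; first by rewrite updateE leqnn.
  by rewrite update_neq ?jm ?orbT // V eqxx /= ltnS [j <= m]leq_eqVlt (negbTE jm).
- split; first by rewrite updateE.
    move=> a' i j /andP[_ a'5]; rewrite update_neq //.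
    by move: a'5; rewrite inE; case: eqP => //= _ ->.
  by move=> i j; rewrite update_neq ?a5 // ltn0 andbF.
exists s'; split => //; apply: runs_le Rs'; lia.
Qed.

Definition fill (a : nat) (x c x' c' : nat) (e : expr) : cmd :=
  for_loop x c (fill_row a (counter x) x' c' e).

Lemma runs_fill (a x c x' c' : nat) (e : expr) (N N' : nat)
    (f : nat -> nat -> nat) (s : store) :
  a != 5 -> a != 0 -> x != x' -> s 0 0 c = N -> s 0 0 c' = N' ->
  (forall s' i j, i < N -> j < N' -> frame a [:: x; x'] s s' ->
     s' 5 x 0 = i -> s' 5 x' 0 = j -> s' a i j = s a i j -> eval s' e = f i j) ->
  exists s', [/\ runs (fill a x c x' c' e) s
                   (N * (N' * (ecost e + 23) + 28) + 12) s',
    frame a [:: x; x'] s s' &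
    forall i j, s' a i j = if (i < N) && (j < N') then f i j else s a i j].
Proof.
move=> a5 a0 xx' sN sN' eP.
pose I m s' := [/\ s' 5 x 0 = m, frame a [:: x; x'] s s' &
   forall i j, s' a i j = if (i < m) && (j < N') then f i j else s a i j].
have [||| s' [Rs' [_ F V]]] := @runs_for I x c (fill_row a (counter x) x' c' e)
    (N' * (ecost e + 23) + 12) N s.
- by move=> m s' [xm F _]; rewrite F ?sN // eq_sym a0.
- move=> m s1 mN [xm F V].
  have F1 s2 : frame a [:: x'] s1 s2 -> frame a [:: x; x'] s s2.
    move=> F' a' i j /andP[H1 H2]; rewrite F' ?F ?H1 //.
    by move: H2; rewrite !inE negb_or; case: eqP => //= _ /andP[].
  have F1x s2 : frame a [:: x'] s1 s2 -> s2 5 x 0 = m.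
    by move=> F'; rewrite F' // inE xx' eq_sym a5.
  have [|||s2 [R2 F2 V2]] := @runs_fill_row a (counter x) x' c' e m N' (f m) s1 a5 a0.
  + by rewrite F ?sN' // eq_sym a0.
  + by move=> s2 /F1x.
  + move=> s2 j jN F2 s2j s2a; apply: eP => //; first exact: F1; first exact: F1x.
    by rewrite s2a V ltnn.
  exists s2; split; first by apply: runs_le R2 => /=; lia.
  split; first exact: F1x.
  split; first by rewrite updateE.
    move=> a' i j H; rewrite update_neq ?(F1 _ F2) //.
    by case: (a' =P 5) H => //= _; rewrite !inE; case: (i == x) => //=; rewrite andbF.
  move=> i j; rewrite update_neq ?a5 // V2 V.
  have [->|im] /= := eqVneq i m; first by rewrite leqnn ltnn; case: ifP.
  by rewrite ltnS [i <= m]leq_eqVlt (negbTE im).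
- split; first by rewrite updateE.
    move=> a' i j /andP[_ a'5]; rewrite update_neq //.
    by move: a'5; rewrite !inE negb_or; case: eqP => //= _ /andP[->].
  by move=> i j; rewrite update_neq ?a5.
exists s'; split => //; apply: runs_le Rs'; lia.
Qed.

(** Truth values are 0 and 1. Truncated subtraction does all tests: the two differences of [e1] and
    [e2] add up to their distance, and 1 - (1 - x) turns any x into a truth value. *)
Definition eq_expr (e1 e2 : expr) : expr :=
  Minus (Const 1) (Plus (Minus e1 e2) (Minus e2 e1)).
Definition lt_expr (e1 e2 : expr) : expr :=
  Minus (Const 1) (Minus (Const 1) (Minus e2 e1)).
Definition not_expr (e : expr) : expr := Minus (Const 1) e.
Definition and_expr (e1 e2 : expr) : expr := Minus (Plus e1 e2) (Const 1).
Definition or_expr (e1 e2 : expr) : expr :=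
  Minus (Const 1) (Minus (Const 1) (Plus e1 e2)).

Lemma eval_eq s e1 e2 : eval s (eq_expr e1 e2) = (eval s e1 == eval s e2).
Proof. by rewrite /=; case: eqP; lia. Qed.

Lemma eval_lt s e1 e2 : eval s (lt_expr e1 e2) = (eval s e1 < eval s e2).
Proof. by rewrite /=; case: ltnP; lia. Qed.

Lemma eval_not s e (b : bool) : eval s e = b -> eval s (not_expr e) = ~~ b.
Proof. by move=> /= ->; case: b. Qed.

Lemma eval_and s e1 e2 (b1 b2 : bool) :
  eval s e1 = b1 -> eval s e2 = b2 -> eval s (and_expr e1 e2) = b1 && b2.
Proof. by move=> /= -> ->; case: b1 b2 => [] []. Qed.

Lemma eval_or s e1 e2 (b1 b2 : bool) :
  eval s e1 = b1 -> eval s e2 = b2 -> eval s (or_expr e1 e2) = b1 || b2.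
Proof. by move=> /= -> ->; case: b1 b2 => [] []. Qed.

Lemma has_iotaS (P : pred nat) m : has P (iota 0 m.+1) = has P (iota 0 m) || P m.
Proof. by rewrite -addn1 iotaD has_cat /= orbF. Qed.

(** * Transitive closure by Warshall's algorithm *)

Fixpoint warshall (E : nat -> nat -> bool) (k i j : nat) : bool :=
  if k is k'.+1 then warshall E k' i j || warshall E k' i k' && warshall E k' k' j
  else E i j || (i == j).

Lemma warshall_trans (E : nat -> nat -> bool) k l i j :
  l < k -> warshall E k i l -> warshall E k l j -> warshall E k i j.
Proof.
elim: k i j => // k IHk i j; rewrite ltnS leq_eqVlt => /predU1P[->|lk] /=.
  move=> /orP[ik|/andP[ik _]] /orP[kj|/andP[_ kj]]; by rewrite ik kj orbT.
have tr a b := IHk a b lk.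
case/orP=> [il|/andP[ik kl]] /orP[lj|/andP[lk' kj]].
- by rewrite (tr i j).
- by rewrite (tr i k) // kj orbT.
- by rewrite ik (tr k j) // orbT.
- by rewrite ik kj orbT.
Qed.

(** Completeness adds the edges of a path one by one at its front through [warshall_trans], all
    vertices being below [n]. *)
Lemma warshall_connect (n : nat) (e : rel 'I_n) (E : nat -> nat -> bool) (i j : 'I_n) :
  (forall a b : 'I_n, E a b = e a b) -> warshall E n i j = connect e i j.
Proof.
move=> Ee; apply/idP/idP.
  suff sound k (a b : 'I_n) : k <= n -> warshall E k a b -> connect e a b by exact: sound.
  elim: k a b => [|k IHk] a b kn /=.
    rewrite Ee => /orP[/connect1//|/eqP/val_inj->]; exact: connect0.
  case/orP=> [|/andP[ak kb]]; first by apply: IHk; rewrite ltnW.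
  by apply: (@connect_trans _ _ (Ordinal kn)); apply: IHk => //; rewrite ltnW.
have base k a b : E a b || (a == b) -> warshall E k a b.
  by elim: k => //= k IHk /IHk ->.
case/connectP=> p pP ->; elim: p i pP => [|x p IHp] i /=.
  by move=> _; apply: base; rewrite eqxx orbT.
case/andP=> ix xp; apply: warshall_trans (ltn_ord x) _ (IHp x xp).
by apply: base; rewrite Ee ix.
Qed.

(** Array 7 receives the new table while array 6 is still being read, so that one step is exactly
    one level of the recursion of [warshall]. *)
Definition warshall_step_cmd : cmd := Seq
  (fill 7 1 0 2 0 (or_expr (Get 6 (counter 1) (counter 2))
     (and_expr (Get 6 (counter 1) (counter 0)) (Get 6 (counter 0) (counter 2)))))
  (fill 6 1 0 2 0 (Get 7 (counter 1) (counter 2))).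

(** Array 1 is read with its indices exchanged, because the edge from i to j is the entry (j, i). *)
Definition closure_cmd : cmd :=
  Seq (fill 6 0 0 1 0 (or_expr (Get 1 (counter 1) (counter 0))
    (eq_expr (counter 0) (counter 1))))
  (for_loop 0 0 warshall_step_cmd).

(** No monomial is a power of [p] alone: for [n] = 0 the input size is 0 whatever [p] is. *)
Definition time_bound (c n p : nat) : nat := c * (1 + n + n * n + n * n * n + n * n * p).

Lemma runs_closure (n : nat) (E : nat -> nat -> bool) (s : store) :
  s 0 0 0 = n -> (forall i j, i < n -> j < n -> s 1 j i = E i j) ->
  exists s', [/\ runs closure_cmd s (time_bound 1000 n 0) s',
    forall a i j, a \notin [:: 5; 6; 7] -> s' a i j = s a i j &
    forall i j, i < n -> j < n -> s' 6 i j = warshall E n i j].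
Proof.
move=> sn sE.
have [||||||s1 [R1 F1 V1]] := @runs_fill 6 0 0 1 0
    (or_expr (Get 1 (counter 1) (counter 0)) (eq_expr (counter 0) (counter 1))) n n
    (fun i j => warshall E 0 i j) s.
all: try by [].
  move=> s' i j ni nj F ci cj _; apply: eval_or; last by rewrite eval_eq /= ci cj.
  by rewrite /= ci cj F ?sE.
pose I m t := [/\ t 5 0 0 = m,
   forall a i j, a \notin [:: 5; 6; 7] -> t a i j = s a i j &
   forall i j, i < n -> j < n -> t 6 i j = warshall E m i j].
have [|||s' [R' [_ F' V']]] := @runs_for I 0 0 warshall_step_cmd
    ((n * (n * 100 + 28) + 12) * 2) n s1.
- by move=> m t [tm F V]; rewrite F ?sn.
- move=> m t mn [tm F V].
  have [||||||t1 [Rt1 Ft1 Vt1]] := @runs_fill 7 1 0 2 0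
       (or_expr (Get 6 (counter 1) (counter 2)) (and_expr
         (Get 6 (counter 1) (counter 0)) (Get 6 (counter 0) (counter 2)))) n n
       (fun i j => warshall E m.+1 i j) t.
  all: rewrite ?F ?sn //.
    move=> s' i j ni nj F' ci cj _; have c0 : s' 5 0 0 = m by rewrite F'.
    apply: eval_or; first by rewrite /= ci cj F' ?V.
    by apply: eval_and; rewrite /= ?ci ?cj c0 F' ?V.
  have [||||||t2 [Rt2 Ft2 Vt2]] := @runs_fill 6 1 0 2 0 (Get 7 (counter 1) (counter 2)) n n
       (fun i j => warshall E m.+1 i j) t1.
  all: rewrite ?Ft1 ?F ?sn //.
    by move=> s' i j ni nj F' ci cj _; rewrite /= ci cj F' // Vt1 ni nj.
  exists t2; split.
    rewrite muln2 -addnn; apply: runs_seq.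
      by apply: runs_le Rt1; rewrite /=; nia.
    by apply: runs_le Rt2; rewrite /=; nia.
  have c0 : t2 5 0 0 = m by rewrite Ft2 // Ft1.
  split=> //; split; first by rewrite updateE.
    move=> a i j H; have := H; rewrite !inE !negb_or => /and3P[a5 a6 a7].
    by rewrite update_neq ?a5 // Ft2 ?a5 ?a6 // Ft1 ?a5 ?a7 // F.
  by move=> i j ni nj; rewrite update_neq // Vt2 ni nj.
- split; first by rewrite updateE.
    move=> a i j; rewrite !inE !negb_or => /and3P[a5 a6 a7].
    by rewrite update_neq ?a5 // F1 ?a5 ?a6.
  by move=> i j ni nj; rewrite update_neq // V1 ni nj.
exists s'; split=> //; apply: runs_le (runs_seq R1 R').
by rewrite /time_bound /=; nia.
Qed.

(* A vertex is skipped unless its component is non-top linked and it is the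
   least vertex of its component. *)
Definition skipped (R : nat -> nat -> bool) (n u : nat) : bool :=
  has (fun w => R w u && (~~ R u w || (w < u))) (iota 0 n).

Definition skip_expr : expr :=
  or_expr (Get 8 (Const 0) (counter 1))
    (and_expr (Get 6 (counter 0) (counter 1))
      (or_expr (not_expr (Get 6 (counter 1) (counter 0)))
               (lt_expr (counter 0) (counter 1)))).

Definition skip_cmd : cmd := for_loop 0 0 (fill_row 8 (Const 0) 1 0 skip_expr).

Lemma runs_skip (n : nat) (R : nat -> nat -> bool) (s : store) :
  s 0 0 0 = n -> (forall i j, i < n -> j < n -> s 6 i j = R i j) ->
  (forall u, s 8 0 u = 0) ->
  exists s', [/\ runs skip_cmd s (time_bound 1000 n 0) s',
    forall a i j, a \notin [:: 5; 8] -> s' a i j = s a i j &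
    forall u, u < n -> s' 8 0 u = skipped R n u].
Proof.
move=> sn sR s8.
(* The size argument of [skipped] doubles as the number of vertices examined so far. *)
pose I m t := [/\ t 5 0 0 = m,
   forall a i j, a \notin [:: 5; 8] -> t a i j = s a i j &
   forall u, u < n -> t 8 0 u = skipped R m u].
have [|||s' [R' [_ F' V']]] := @runs_for I 0 0 (fill_row 8 (Const 0) 1 0 skip_expr)
    (n * 100 + 12) n s.
- by move=> m t [tm F V]; rewrite F ?sn.
- move=> m t mn [tm F V].
  have [|||||t1 [R1 F1 V1]] := @runs_fill_row 8 (Const 0) 1 0 skip_expr 0 n
       (fun u => skipped R m.+1 u) t.
  all: rewrite ?F ?sn //.
    move=> s' j nj F' cj s'8; have c0 : s' 5 0 0 = m by rewrite F'.
    rewrite /skipped has_iotaS; apply: eval_or; first by rewrite /= cj s'8 V.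
    apply: eval_and; first by rewrite /= cj c0 F' // F // sR.
    apply: eval_or; last by rewrite eval_lt /= c0 cj.
    by apply: eval_not; rewrite /= cj c0 F' // F // sR.
  exists t1; split; first by apply: runs_le R1; rewrite /=; nia.
  have c0 : t1 5 0 0 = m by rewrite F1.
  split=> //; split; first by rewrite updateE.
    move=> a i j H; have := H; rewrite !inE !negb_or => /andP[a5 a8].
    by rewrite update_neq ?a5 // F1 ?a5 ?a8 // F.
  by move=> u un; rewrite update_neq // V1 un.
- split; first by rewrite updateE.
    by move=> a i j; rewrite !inE !negb_or => /andP[a5 a8]; rewrite update_neq ?a5.
  by move=> u un; rewrite update_neq // s8.
exists s'; split=> //; apply: runs_le R'.
by rewrite /time_bound /=; nia.
Qed.

(** The ancestors of a vertex of a non-top linked component are the vertices of this component, so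
    for a kept vertex this is membership in the set S_j. *)
Definition touched_by (R B : nat -> nat -> bool) (n u j : nat) : bool :=
  has (fun r => R r u && B r j) (iota 0 n).

Definition touch_expr : expr :=
  or_expr (Get 9 (counter 1) (counter 2))
    (and_expr (Get 6 (counter 0) (counter 1)) (Get 2 (counter 0) (counter 2))).

Definition touch_cmd : cmd := for_loop 0 0 (fill 9 1 0 2 1 touch_expr).

Lemma runs_touch (n p : nat) (R B : nat -> nat -> bool) (s : store) :
  s 0 0 0 = n -> s 0 0 1 = p ->
  (forall i j, i < n -> j < n -> s 6 i j = R i j) ->
  (forall i j, i < n -> j < p -> s 2 i j = B i j) ->
  (forall u j, s 9 u j = 0) ->
  exists s', [/\ runs touch_cmd s (time_bound 1000 n p) s',
    forall a i j, a \notin [:: 5; 9] -> s' a i j = s a i j &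
    forall u j, u < n -> j < p -> s' 9 u j = touched_by R B n u j].
Proof.
move=> sn sp sR sB s9.
pose I m t := [/\ t 5 0 0 = m,
   forall a i j, a \notin [:: 5; 9] -> t a i j = s a i j &
   forall u j, u < n -> j < p -> t 9 u j = touched_by R B m u j].
have [|||s' [R' [_ F' V']]] := @runs_for I 0 0 (fill 9 1 0 2 1 touch_expr)
    (n * (p * 100 + 28) + 12) n s.
- by move=> m t [tm F V]; rewrite F ?sn.
- move=> m t mn [tm F V].
  have [||||||t1 [R1 F1 V1]] := @runs_fill 9 1 0 2 1 touch_expr n p
       (fun u j => touched_by R B m.+1 u j) t.
  all: rewrite ?F ?sn ?sp //.
    move=> s' i j ni nj F' ci cj s'9; have c0 : s' 5 0 0 = m by rewrite F'.
    rewrite /touched_by has_iotaS; apply: eval_or; first by rewrite /= ci cj s'9 V.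
    by apply: eval_and; rewrite /= ?ci ?cj c0 F' // F // ?sR ?sB.
  exists t1; split; first by apply: runs_le R1; rewrite /=; nia.
  have c0 : t1 5 0 0 = m by rewrite F1.
  split=> //; split; first by rewrite updateE.
    move=> a i j H; have := H; rewrite !inE !negb_or => /andP[a5 a9].
    by rewrite update_neq ?a5 // F1 ?a5 ?a9 // F.
  by move=> u j un jp; rewrite update_neq // V1 un jp.
- split; first by rewrite updateE.
    by move=> a i j; rewrite !inE !negb_or => /andP[a5 a9]; rewrite update_neq ?a5.
  by move=> u j un jp; rewrite update_neq // s9.
exists s'; split=> //; apply: runs_le R'.
by rewrite /time_bound /=; nia.
Qed.

(* The row of a skipped vertex is written too, and overwritten by the next one. *)
Definition emit_step_cmd : cmd := Seq
  (fill_row 4 (cell 3 0 0) 1 1 (Get 9 (counter 0) (counter 1)))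
  (Put 3 (Const 0) (Const 0)
    (Plus (cell 3 0 0) (not_expr (Get 8 (Const 0) (counter 0))))).

Definition emit_cmd : cmd := for_loop 0 0 emit_step_cmd.

Lemma runs_emit (n p : nat) (skip : nat -> bool) (T : nat -> nat -> bool) (s : store) :
  s 0 0 0 = n -> s 0 0 1 = p -> s 3 0 0 = 0 ->
  (forall u, u < n -> s 8 0 u = skip u) ->
  (forall u j, u < n -> j < p -> s 9 u j = T u j) ->
  let kept := [seq u <- iota 0 n | ~~ skip u] in
  exists s', [/\ runs emit_cmd s (time_bound 1000 n p) s', s' 3 0 0 = size kept &
    forall i j, i < size kept -> j < p -> s' 4 i j = T (nth 0 kept i) j].
Proof.
move=> sn sp s3 s8 s9 kept.
pose kept_below m := [seq u <- iota 0 m | ~~ skip u].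
pose I m t := [/\ t 5 0 0 = m,
   forall a i j, a \notin [:: 3; 4; 5] -> t a i j = s a i j,
   t 3 0 0 = size (kept_below m) &
   forall i j, i < size (kept_below m) -> j < p -> t 4 i j = T (nth 0 (kept_below m) i) j].
have [|||s' [R' [_ F' V3 V4]]] := @runs_for I 0 0 emit_step_cmd
    (p * 100 + 112) n s.
- by move=> m t [tm F V]; rewrite F ?sn.
- move=> m t mn [tm F t3 t4].
  have [|||||t1 [R1 F1 V1]] := @runs_fill_row 4 (cell 3 0 0) 1 1
      (Get 9 (counter 0) (counter 1)) (size (kept_below m)) p (T m) t.
  all: rewrite ?F ?sn ?sp //.
  + by move=> s' F'; rewrite /= F'.
  + move=> s' j nj F' cj _; have c0 : s' 5 0 0 = m by rewrite F'.
    by rewrite /= cj c0 F' // F // s9.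
  have c0 : t1 5 0 0 = m by rewrite F1.
  have e8 : t1 8 0 m = skip m by rewrite F1 // F // s8.
  have e3 : t1 3 0 0 = size (kept_below m) by rewrite F1.
  have keptS : kept_below m.+1 = kept_below m ++ [seq u <- [:: m] | ~~ skip u].
    by rewrite /kept_below -addn1 iotaD filter_cat.
  have sizeS : size (kept_below m.+1) = size (kept_below m) + ~~ skip m.
    by rewrite keptS size_cat /=; case: (skip m).
  exists (update t1 3 0 0 (size (kept_below m.+1))); split.
    have -> : p * 100 + 112 = (p * 100 + 12) + 100 by lia.
    apply: runs_seq; first by apply: runs_le R1; rewrite /=; nia.
    have -> : size (kept_below m.+1) = eval t1
        (Plus (cell 3 0 0) (not_expr (Get 8 (Const 0) (counter 0)))).
      by rewrite sizeS /= e3 c0 e8; case: (skip m).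
    exact: runs_put.
  rewrite update_neq //; split=> //; split.
  + by rewrite updateE.
  + move=> a i j H; have := H; rewrite !inE !negb_or => /and3P[a3 a4 a5].
    by rewrite update_neq ?a5 // update_neq ?a3 // F1 ?a5 ?a4 // F.
  + by rewrite update_neq // updateE.
  + move=> i j; rewrite sizeS => im jp; rewrite !update_neq // V1 jp andbT keptS nth_cat.
    case: eqP => [ei|/eqP ni].
      by rewrite ei ltnn subnn /=; move: im; rewrite ei; case: (skip m) => //=; lia.
    have il : i < size (kept_below m) by move: im ni; case: (skip m) => /=; lia.
    by rewrite il t4.
- split => // a i j.
  by rewrite !inE !negb_or => /and3P[a3 a4 a5]; rewrite update_neq ?a5.
exists s'; split=> //; apply: runs_le R'.
(* The cost n * p of this loop is absorbed by n * n * p, also for [n] = 0. *)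
have : n * p <= n * n * p by case: (n) => // l; rewrite leq_mul // leq_pmulr.
by rewrite /time_bound /=; nia.
Qed.

(** * Non-top linked components *)

Definition scc (n : nat) (A : smatrix n n) (v : 'I_n) : {set 'I_n} :=
  [set w | connect (state_edge A) v w && connect (state_edge A) w v]%SET.

Lemma sccsP (n : nat) (A : smatrix n n) (C : {set 'I_n}) :
  reflect (exists v, C = scc A v) (C \in sccs A).
Proof.
apply: (iffP imsetP) => [[v _ ->]|[v ->]]; exists v; rewrite ?inE //.
  by apply/setP => w; rewrite !inE.
by apply/setP => w; rewrite !inE.
Qed.

Lemma mem_scc (n : nat) (A : smatrix n n) (v : 'I_n) : v \in scc A v.
Proof. by rewrite inE !connect0. Qed.

Lemma scc_eq (n : nat) (A : smatrix n n) (v w : 'I_n) :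
  (scc A v == scc A w) = (w \in scc A v).
Proof.
apply/eqP/idP => [->|]; first exact: mem_scc.
rewrite inE => /andP[vw wv]; apply/setP => x; rewrite !inE.
by apply/andP/andP => -[H1 H2]; split; apply: connect_trans; eauto.
Qed.

(** A path to [v] from outside its component would contain an edge entering the component. This
    reduces the notion to reachability, which the program can test. *)
Lemma non_top_linkedP (n : nat) (A : smatrix n n) (v : 'I_n) :
  non_top_linked A (scc A v) <->
  forall w, connect (state_edge A) w v -> connect (state_edge A) v w.
Proof.
split=> [ntl w /connectP[p pP vE]|reach C' /sccsP[w ->] neq i j iw jv].
  elim: p w pP vE => [|x p IHp] w /= => [_ ->|/andP[wx xp] vE]; first exact: connect0.
  have vx := IHp x xp vE.
  have xv : connect (state_edge A) x v by apply/connectP; exists p.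
  have [wv|wv] := boolP (w \in scc A v); first by move: wv; rewrite inE => /andP[].
  have := ntl (scc A w) _ _ w x (mem_scc A w) _; rewrite wx => H.
  suff : ~~ true by []; apply: H; first by apply/sccsP; exists w.
    by rewrite eq_sym scc_eq.
  by rewrite inE vx.
apply: contra neq => ij; rewrite scc_eq inE.
move: iw jv; rewrite !inE => /andP[wi iw] /andP[vj jv].
have iv : connect (state_edge A) i v by apply: connect_trans jv; exact: connect1.
by rewrite (connect_trans wi iv) (connect_trans (reach i iv) iw).
Qed.

(** Take an ancestor [u] of [v] with the fewest ancestors: an ancestor of [u] not reachable from [u]
    would have strictly fewer. *)
Lemma non_top_linked_ancestor (n : nat) (A : smatrix n n) (v : 'I_n) :
  exists2 u, non_top_linked A (scc A u) & connect (state_edge A) u v.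
Proof.
pose anc u := #|[set w | connect (state_edge A) w u]%SET|.
case: (@arg_minnP _ v (fun u => connect (state_edge A) u v) anc (connect0 _ v)) => u uv umin.
exists u => //; apply/non_top_linkedP => w wu; apply: contraT => uw.
have := umin w (connect_trans wu uv); rewrite leqNgt => /negP[].
apply: proper_card; apply/properP; split.
  by apply/fintype.subsetP => x; rewrite !inE => /connect_trans; apply.
by exists u; rewrite inE ?connect0.
Qed.

(** * Correctness and cost of the reduction program *)

Definition reduction_cmd : cmd :=
  Seq closure_cmd (Seq skip_cmd (Seq touch_cmd emit_cmd)).

Definition entryb (a b : nat) (M : smatrix a b) (i j : nat) : bool := 0 < entry M i j.

Lemma entryE (a b : nat) (M : smatrix a b) i j : entry M i j = entryb M i j.
Proof. by rewrite /entryb /entry; do 2 case: insub => // ?; case: (M _ _). Qed.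

Lemma entryb_ord (a b : nat) (M : smatrix a b) (i : 'I_a) (j : 'I_b) : entryb M i j = M i j.
Proof. by rewrite /entryb /entry !valK; case: (M i j). Qed.

Lemma runs_reduction (n p : nat) (A : smatrix n n) (B : smatrix n p)
    (R := warshall (fun i j => entryb A j i) n)
    (kept := [seq u <- iota 0 n | ~~ skipped R n u]) :
  exists s', [/\ runs reduction_cmd (input_store A B) (time_bound 4000 n p) s',
    s' 3 0 0 = size kept &
    forall i j, i < size kept -> j < p ->
      s' 4 i j = touched_by R (entryb B) n (nth 0 kept i) j].
Proof.
have [||s1 [R1 F1 V1]] := @runs_closure n (fun i j => entryb A j i) (input_store A B).
all: try by [].
  by move=> i j _ _; rewrite /= entryE.
have [|||s2 [R2 F2 V2]] := @runs_skip n R s1; [by rewrite F1| by []|by move=> u; rewrite F1|].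
have [|||||s3 [R3 F3 V3]] := @runs_touch n p R (entryb B) s2.
- by rewrite F2 ?F1.
- by rewrite F2 ?F1.
- by move=> i j ni nj; rewrite F2 ?V1.
- by move=> i j _ _; rewrite F2 ?F1 //= entryE.
- by move=> u j; rewrite F2 ?F1.
have [|||||s4 [R4 V4 W4]] := @runs_emit n p (skipped R n) (touched_by R (entryb B) n) s3.
- by rewrite F3 ?F2 ?F1.
- by rewrite F3 ?F2 ?F1.
- by rewrite F3 ?F2 ?F1.
- by move=> u un; rewrite F3 ?V2.
- exact: V3.
exists s4; split=> //; apply: runs_le (runs_seq R1 (runs_seq R2 (runs_seq R3 R4))).
by rewrite /time_bound; nia.
Qed.

(** The cubic terms add up to [n] times the input size, and [n] is at most the input size. *)
Lemma time_bound_input_size (c n p : nat) :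
  time_bound c n p <= c * ((input_size n p).+1 * (input_size n p).+1).
Proof.
rewrite /time_bound /input_size leq_mul2l; apply/orP; right.
by case: n => // n; nia.
Qed.

Section KeptVertices.
Variables (n p : nat) (A : smatrix n n) (B : smatrix n p).
Let R := warshall (fun i j => entryb A j i) n.
Let kept := [seq u <- iota 0 n | ~~ skipped R n u].

Let R_connect (i j : 'I_n) : R i j = connect (state_edge A) i j.
Proof. by apply: warshall_connect => a b; rewrite entryb_ord. Qed.

Lemma skippedP (u : 'I_n) :
  reflect (non_top_linked A (scc A u) /\ forall w : 'I_n, w \in scc A u -> u <= w)
    (~~ skipped R n u).
Proof.
apply: (iffP hasPn) => [keep|[ntl umin] w].
  split=> [|w].
    apply/non_top_linkedP => w wu; have := keep w; rewrite mem_iota ltn_ord => /(_ isT).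
    by rewrite !R_connect wu negb_or negbK => /andP[].
  rewrite inE => /andP[uw wu]; have := keep w; rewrite mem_iota ltn_ord => /(_ isT).
  by rewrite !R_connect wu negb_or -leqNgt => /andP[].
rewrite mem_iota => /= wn; apply/negP => /andP[].
rewrite (R_connect (Ordinal wn) u) (R_connect u (Ordinal wn)) => wu.
have uw := (non_top_linkedP A u).1 ntl _ wu.
by rewrite uw /= ltnNge (umin (Ordinal wn)) // inE uw.
Qed.

Let kept_lt (i : 'I_(size kept)) : nth 0 kept i < n.
Proof.
have : nth 0 kept i \in kept by apply: mem_nth.
by rewrite mem_filter mem_iota => /andP[].
Qed.

Definition kept_scc (i : 'I_(size kept)) : {set 'I_n} := scc A (Ordinal (kept_lt i)).

(** Each component is represented by its least vertex: uniqueness of this vertex gives injectivity,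
    and its position in [kept] is the index of the component. *)
Lemma kept_sccs : non_top_linked_sccs A kept_scc.
Proof.
have keptP i : ~~ skipped R n (Ordinal (kept_lt i)).
  have : nth 0 kept i \in kept by apply: mem_nth.
  by rewrite mem_filter => /andP[].
split=> [i j ij|C].
  have [_ mini] := skippedP _ (keptP i); have [_ minj] := skippedP _ (keptP j).
  have inj : nth 0 kept i = nth 0 kept j.
    apply/eqP; rewrite eqn_leq; apply/andP; split.
      by apply: (mini (Ordinal (kept_lt j))); rewrite -/(kept_scc i) ij mem_scc.
    by apply: (minj (Ordinal (kept_lt i))); rewrite -/(kept_scc j) -ij mem_scc.
  apply/val_inj/eqP; rewrite -(nth_uniq 0 (ltn_ord i) (ltn_ord j)) ?inj //.
  by rewrite filter_uniq ?iota_uniq.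
split=> [[/sccsP[v ->] ntl]|[i <-]]; last first.
  have [ntl _] := skippedP _ (keptP i); split => //.
  by apply/sccsP; exists (Ordinal (kept_lt i)).
case: (@arg_minnP _ v (mem (scc A v)) (fun w => w : nat) (mem_scc A v)) => u uv umin.
have scc_uv : scc A v = scc A u by apply/eqP; rewrite scc_eq.
have uk : (u : nat) \in kept.
  rewrite mem_filter mem_iota /= ltn_ord andbT; apply/skippedP.
  by split=> [|w]; rewrite -scc_uv //; apply: umin.
have ik : index (u : nat) kept < size kept by rewrite index_mem.
exists (Ordinal ik); rewrite scc_uv; congr scc; apply/val_inj => /=.
by rewrite nth_index.
Qed.

Lemma reduction_computes :
  computes_within reduction_cmd (time_bound 4000 n p) A B (cover_sets B kept_scc).
Proof.
have [s' [[t tb et] V3 V4]] := runs_reduction A B.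
exists t, s'; split=> //; split=> // i j; rewrite V4 //; congr nat_of_bool.
rewrite inE; apply/hasP/existsP => [[r]|[r /andP[]]].
  rewrite mem_iota => /= rn /andP[Rru Brj]; exists (Ordinal rn).
  rewrite -[B _ _]entryb_ord Brj andbT inE.
  have ru : connect (state_edge A) (Ordinal rn) (Ordinal (kept_lt i)).
    by rewrite -R_connect.
  rewrite ru andbT; apply: (non_top_linkedP A _).1 ru.
  have [ntl _] : non_top_linked A (kept_scc i) /\ True.
    by split => //; have [_ /(_ (kept_scc i))[_]] := kept_sccs; case=> //; exists i.
  exact: ntl.
rewrite inE => /andP[_ ru] Brj; exists (r : nat); first by rewrite mem_iota /= ltn_ord.
rewrite entryb_ord Brj andbT.
by have := R_connect r (Ordinal (kept_lt i)); rewrite ru => /= H.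
Qed.

End KeptVertices.

(** * Steering by polynomial inputs *)

Local Open Scope classical_set_scope.
Local Open Scope ring_scope.

(** The derivative of q (X - c)^(n+1) is a multiple of (X - c)^n whose cofactor takes the value
    (n+1) q(c) at c. *)
Lemma derivn_mul_expXsubC (R : comNzRingType) (c : R) (n j : nat) (q : {poly R}) :
  (j <= n)%N ->
  (q * ('X - c%:P) ^+ n)^`(j).[c] = if j == n then q.[c] *+ n`! else 0.
Proof.
elim: n j q => [|n IHn] [|j] q // jn.
- by rewrite derivn0 expr0 mulr1 fact0 mulr1n.
- by rewrite derivn0 exprS mulrCA hornerM hornerXsubC subrr mul0r.
rewrite derivSn derivM deriv_exp derivXsubC mul1r.
have -> : q^`() * ('X - c%:P) ^+ n.+1 + q * (('X - c%:P) ^+ n *+ n.+1) =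
   (q^`() * ('X - c%:P) + q *+ n.+1) * ('X - c%:P) ^+ n.
  by rewrite exprS -mulr_natr -[q *+ _]mulr_natr; ring.
rewrite IHn // eqSS; case: eqP => // _.
by rewrite !hornerE subrr mulr0 add0r hornerMn -mulrnA factS mulnC.
Qed.

(** Induction on [n], with the correction (al + be X) (X - 1)^n X^n. It has roots of multiplicity at
    least [n] at 0 and 1, so the derivatives already matched are kept, and [al], [be] adjust the
    [n]-th ones. *)
Lemma hermite_interpolation (R : numFieldType) (n : nat) (a b : nat -> R) :
  exists y : {poly R}, forall i, (i < n)%N ->
    y^`(i).[0] = a i /\ y^`(i).[1] = b i.
Proof.
elim: n => [|n [y yP]]; first by exists 0.
pose al := (a n - y^`(n).[0]) / (n`!%:R * (-1) ^+ n).
pose be := (b n - y^`(n).[1]) / n`!%:R - al.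
pose q0 : {poly R} := (al%:P + be *: 'X) * ('X - 1%:P) ^+ n.
pose q1 : {poly R} := (al%:P + be *: 'X) * ('X - 0%:P) ^+ n.
have fN0 : (n`!%:R : R) != 0 by rewrite pnatr_eq0 -lt0n fact_gt0.
have e01 : q1 * ('X - 1%:P) ^+ n = q0 * ('X - 0%:P) ^+ n by rewrite mulrAC.
exists (y + q0 * ('X - 0%:P) ^+ n) => i; rewrite ltnS => lein.
rewrite !derivnD !hornerD; split.
  rewrite derivn_mul_expXsubC //; case: eqP lein => [-> _|/eqP neq lein].
    rewrite /q0 !(hornerE, horner_exp) -mulr_natr.
    have sgn : ((-1 : R) ^+ n) != 0 by rewrite signr_eq0.
    rewrite /al; field.
    by rewrite fN0 sgn.
  by rewrite addr0; have [|-> _] := yP i; rewrite // ltn_neqAle neq.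
rewrite -e01 derivn_mul_expXsubC //; case: eqP lein => [-> _|/eqP neq lein].
  rewrite /q1 hornerM hornerD hornerC hornerZ hornerX horner_exp hornerXsubC.
  rewrite subr0 expr1n !mulr1 -mulr_natr.
  by rewrite subrKC divfK // subrKC.
by rewrite addr0; have [|_ ->] := yP i; rewrite // ltn_neqAle neq.
Qed.

Lemma unitriangular_solve (R : nzRingType) (n : nat) (g : nat -> nat -> R)
    (d : nat -> R) :
  (forall j, (j < n)%N -> g j j = 1) ->
  exists a : nat -> R, forall j, (j < n)%N -> \sum_(i < j.+1) g j i * a i = d j.
Proof.
elim: n => [|n IHn] g1; first by exists (fun=> 0).
have [|a aP] := IHn; first by move=> j jn; apply: g1; rewrite ltnS ltnW.
exists (fun i => if i == n then d n - \sum_(i < n) g n i * a i else a i) => j.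
rewrite ltnS leq_eqVlt => /predU1P[->|jn].
  rewrite big_ord_recr /= eqxx g1 // mul1r.
  rewrite (eq_bigr (fun i : 'I_n => g n i * a i)) ?subrKC //.
  by move=> i _; rewrite ltn_eqF.
rewrite -(aP j jn); apply: eq_bigr => i _.
by rewrite ltn_eqF // (leq_trans (ltn_ord i)).
Qed.

Lemma is_derive_horner_col (R : realType) (n : nat) (X : 'cV[{poly R}]_n) (t : R) :
  is_derive t 1 (fun s : R => map_mx (horner_eval s) X : 'cV[R]_n)
    (map_mx (horner_eval t) (map_mx deriv X)).
Proof.
have dX : derivable (fun s : R => map_mx (horner_eval s) X : 'cV[R]_n) t 1.
  apply/derivable_mxP => i j.
  rewrite (_ : (fun s : R => _) = horner (X i j)); first exact: derivable_horner.
  by apply/funext => s; rewrite mxE.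
apply: DeriveDef => //; rewrite derive_mx //; apply/matrixP => i j; rewrite !mxE.
rewrite (_ : (fun s : R => _) = horner (X i j)); first exact: derive_val.
by apply/funext => s; rewrite mxE.
Qed.

Lemma continuous_horner_col (R : realType) (n : nat) (X : 'cV[{poly R}]_n) :
  continuous (fun s : R => map_mx (horner_eval s) X : 'cV[R]_n).
Proof.
move=> t; apply: differentiable_continuous; apply/derivable1_diffP.
by have [] := is_derive_horner_col X t.
Qed.

Lemma map_deriv_mul (R : nzRingType) (m n p : nat) (A : 'M[R]_(m, n))
    (Y : 'M[{poly R}]_(n, p)) :
  map_mx deriv (map_mx polyC A *m Y) = map_mx polyC A *m map_mx deriv Y.
Proof.
apply/matrixP => i j; rewrite !mxE raddf_sum; apply: eq_bigr => k _.
by rewrite !mxE /= derivM derivC mul0r add0r.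
Qed.

Lemma expr_size_cayley_hamilton (R : comNzRingType) (n' : nat) (A : 'M[R]_n'.+1) :
  A ^+ n'.+1 = - \sum_(k < n'.+1) (char_poly A)`_k *: A ^+ k.
Proof.
apply/eqP; rewrite -subr_eq0 opprK addrC; apply/eqP.
have := Cayley_Hamilton A; rewrite -[X in horner_mx _ X]coefK poly_def size_char_poly.
rewrite linear_sum /= big_ord_recr /= linearZ /= rmorphXn /= horner_mx_X.
under eq_bigr do rewrite linearZ /= rmorphXn /= horner_mx_X.
have /monicP := char_poly_monic A; rewrite lead_coefE size_char_poly /= => ->.
by rewrite scale1r.
Qed.

Lemma map_horner_mul (R : comNzRingType) (m n p : nat) (t : R) (A : 'M[R]_(m, n))
    (Y : 'M[{poly R}]_(n, p)) :
  map_mx (horner_eval t) (map_mx polyC A *m Y) = A *m map_mx (horner_eval t) Y.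
Proof.
apply/matrixP => i j; rewrite !mxE /horner_eval horner_sum; apply: eq_bigr => k _.
by rewrite !mxE hornerM hornerC.
Qed.

Section Steering.
Variables (R : realType) (n' m : nat).
Local Notation n := n'.+1.
Variables (A : 'M[R]_n) (B : 'M[R]_(n, m)).

(** The family [V] satisfies V_k = V_(k+1)' + c_k Y and V_n = Y. Hence the derivative of [X] is the
    sum of A^k B (V_k - c_k Y), where by Cayley-Hamilton the terms in c_k Y contribute A^n B V_n;
    shifting the index gives the equation with input V_0. *)
Lemma polynomial_trajectory (Y : 'cV[{poly R}]_m)
    (V := fun k => \sum_(i < n.+1 - k)
       ((char_poly A)`_(k + i))%:P *: iter i (map_mx deriv) Y)
    (X := \sum_(k < n) map_mx polyC (A ^+ k *m B) *m V k.+1) :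
  map_mx deriv X = map_mx polyC A *m X + map_mx polyC B *m V 0.
Proof.
pose c k := ((char_poly A)`_k)%:P.
pose D : 'cV[{poly R}]_m -> 'cV[{poly R}]_m := map_mx deriv.
have VS k : (k <= n)%N -> D (V k.+1) = V k - c k *: Y.
  move=> kn; rewrite /V (subSn kn) big_ord_recl addn0 /= addrC addKr.
  rewrite /D raddf_sum; rewrite subSS; apply: eq_bigr => i _.
  rewrite addSnnS /=; apply/matrixP => a b; rewrite !mxE.
  by rewrite derivM derivC mul0r add0r.
have dX : map_mx deriv X =
    \sum_(k < n) map_mx polyC (A ^+ k *m B) *m (V k - c k *: Y).
  rewrite /X raddf_sum; apply: eq_bigr => k _.
  by rewrite [LHS]map_deriv_mul -[map_mx deriv _]/(D _) VS // ltnW.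
have Vn : V n = Y.
  rewrite /V subSn // subnn big_ord1 addn0 /=.
  have /monicP := char_poly_monic A; rewrite lead_coefE size_char_poly /= => ->.
  by rewrite scale1r.
have CH : \sum_(k < n) map_mx polyC (A ^+ k *m B) *m (c k *: Y) =
    - (map_mx polyC (A ^+ n *m B) *m Y).
  rewrite expr_size_cayley_hamilton mulNmx raddfN mulNmx opprK.
  rewrite mulmx_suml raddf_sum /= mulmx_suml; apply: eq_bigr => k _.
  by rewrite -scalemxAl map_mxZ -scalemxAr -scalemxAl.
rewrite dX; under eq_bigr do rewrite mulmxBr.
rewrite sumrB CH opprK big_ord_recl expr0 mul1mx -addrA addrC; congr (_ + _).
rewrite /X mulmx_sumr big_ord_recr /= Vn; congr (_ + _).
  apply: eq_bigr => k _; rewrite /bump /= add1n.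
  by rewrite mulmxA -map_mxM mulmxA exprS.
by rewrite mulmxA -map_mxM mulmxA exprS.
Qed.

Lemma kalman_controllable :
  (forall z : 'cV[R]_n, exists w : nat -> 'cV[R]_m,
     z = \sum_(k < n) A ^+ k *m B *m w k) ->
  controllable A B.
Proof.
move=> kalman x0 x1; exists 1; split=> //.
have [w0 x0E] := kalman x0; have [w1 x1E] := kalman x1.
pose c k := (char_poly A)`_k.
have cn : c n = 1.
  by have /monicP := char_poly_monic A; rewrite lead_coefE size_char_poly.
(* With j = n' - k, the values of the V_(k+1) at a given time are a unitriangular system in the
   derivatives of [Y] at that time, with diagonal [c n] = 1. *)
have jets (w : nat -> 'cV[R]_m) (l : 'I_m) : exists a : nat -> R,
    forall j, (j < n)%N ->
      \sum_(i < j.+1) c (n - j + i)%N * a i = w (n' - j)%N l 0.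
  have [|a aP] := @unitriangular_solve R n (fun j i => c (n - j + i)%N)
    (fun j => w (n' - j)%N l 0); last by exists a.
  by move=> j jn; rewrite subnK // ltnW.
have [a0 a0P] := choice (jets w0); have [a1 a1P] := choice (jets w1).
have [y yP] := choice (fun l => hermite_interpolation n (a0 l) (a1 l)).
pose Y : 'cV[{poly R}]_m := \col_l y l.
pose V k := \sum_(i < n.+1 - k) (c (k + i)%N)%:P *: iter i (map_mx deriv) Y.
pose X := \sum_(k < n) map_mx polyC (A ^+ k *m B) *m V k.+1.
have iterY i : iter i (map_mx deriv) Y = \col_l (y l)^`(i).
  elim: i => [|i IHi] /=; first by apply/matrixP => a b; rewrite !mxE.
  by rewrite IHi; apply/matrixP => a b; rewrite !mxE.
have Vt t k l : (k < n)%N -> (V k.+1 l 0).[t] =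
    \sum_(i < (n' - k).+1) c (n - (n' - k) + i)%N * (y l)^`(i).[t].
  rewrite ltnS => kn; rewrite /V summxE horner_sum subSS subSn //.
  apply: eq_bigr => i _; rewrite iterY !mxE hornerM hornerC.
  by rewrite subSn ?leq_subr // subKn.
have Xt t w : (forall k, (k < n)%N -> map_mx (horner_eval t) (V k.+1) = w k) ->
    map_mx (horner_eval t) X = \sum_(k < n) A ^+ k *m B *m w k.
  move=> Vw; rewrite /X raddf_sum; apply: eq_bigr => k _.
  by rewrite [LHS]map_horner_mul; congr (_ *m _); exact: Vw.
exists (fun t : R => map_mx (horner_eval t) (V 0%N)).
exists (fun t : R => map_mx (horner_eval t) X); split.
- exact/continuous_subspaceT/continuous_horner_col.
- exact/continuous_subspaceT/continuous_horner_col.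
- move=> t _; have := is_derive_horner_col X t.
  rewrite (polynomial_trajectory Y) -!map_horner_mul.
  by rewrite (_ : map_mx _ (_ + _) = map_mx (horner_eval t) (map_mx polyC A *m X) +
    map_mx (horner_eval t) (map_mx polyC B *m V 0%N)) //; exact: raddfD.
- rewrite x0E; apply: Xt => k kn; apply/matrixP => l z; rewrite ord1 mxE /horner_eval Vt //.
  rewrite -[k in RHS](@subKn k n') // -a0P ?ltnS ?leq_subr //.
  apply: eq_bigr => i _; congr (_ * _); have [|//] := yP l i.
  by rewrite (leq_trans (ltn_ord i)) // ltnS leq_subr.
- rewrite x1E; apply: Xt => k kn; apply/matrixP => l z; rewrite ord1 mxE /horner_eval Vt //.
  rewrite -[k in RHS](@subKn k n') // -a1P ?ltnS ?leq_subr //.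
  apply: eq_bigr => i _; congr (_ * _); have [|//] := yP l i.
  by rewrite (leq_trans (ltn_ord i)) // ltnS leq_subr.
Qed.

End Steering.

(** * From the eigenvector test to the Kalman condition *)

Lemma stable_eigenvector (C : numClosedFieldType) (n m : nat) (A : 'M[C]_n)
    (L : 'M[C]_(m, n)) :
  stablemx L A -> L != 0 ->
  exists lam, exists2 v : 'rV[C]_n, v != 0 & (v <= L)%MS /\ v *m A = lam *: v.
Proof.
move=> LA L0; have rL : (0 < \rank L)%N by rewrite lt0n mxrank_eq0.
have [lam /eigenvalueP[v /eigenspaceP vA v0]] :=
  eigenvalue_closed (restrictmx L A) rL.
exists lam, (v *m row_base L); first by rewrite mulmx_free_eq0 ?row_base_free.
split; first by rewrite (submx_trans (submxMl _ _)) // eq_row_base.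
by apply/eigenspaceP; rewrite -sub_eigenspace_conjmx ?row_base_free ?stablemx_row_base.
Qed.

(** If the columns of the A^k B do not span, their left annihilator [L] is nonzero and stable under
    [A]; over the closed field it contains a left eigenvector, killed by [B]. *)
Lemma hautus_kalman (R : fieldType) (C : numClosedFieldType)
    (f : {rmorphism R -> C}) (n' m : nat) (A : 'M[R]_n'.+1)
    (B : 'M[R]_(n'.+1, m)) :
  (forall (lam : C) (v : 'rV[C]_n'.+1),
     v *m map_mx f A = lam *: v ->
     v *m map_mx f B = 0 -> v = 0) ->
  forall z : 'cV[R]_n'.+1, exists w : nat -> 'cV[R]_m,
    z = \sum_(k < n'.+1) A ^+ k *m B *m w k.
Proof.
move=> hautus z.
pose S := (\sum_(k < n'.+1) <<(A ^+ k *m B)^T>>)%MS.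
have annS m' (u : 'M[R]_(m', n'.+1)) :
    u *m S^T = 0 <-> forall k : 'I_n'.+1, u *m (A ^+ k *m B) = 0.
  have -> : u *m S^T = 0 <-> (S <= kermx u^T)%MS.
    split=> [uS|/sub_kermxP uS]; last by apply: trmx_inj; rewrite trmx_mul trmxK uS trmx0.
    by apply/sub_kermxP; apply: trmx_inj; rewrite trmx_mul trmxK uS trmx0.
  split=> [/sumsmx_subP uS k|uS].
    have := uS k isT; rewrite genmxE => /sub_kermxP H.
    by apply: trmx_inj; rewrite trmx_mul H trmx0.
  apply/sumsmx_subP => k _; rewrite genmxE; apply/sub_kermxP.
  by rewrite -trmx_mul uS trmx0.
have Sfull : row_full S.
  apply/negPn/negP => nfull.
  pose L := kermx S^T.
  have L0 : L != 0.
    rewrite -mxrank_eq0 mxrank_ker mxrank_tr -lt0n subn_gt0.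
    by rewrite ltn_neqAle nfull rank_leq_col.
  have /annS LS : L *m S^T = 0 := mulmx_ker _.
  have LA : stablemx L A.
    apply/sub_kermxP; apply/annS => k.
    rewrite -mulmxA (mulmxA A) -[A *m _]/(A * A ^+ k) -exprS.
    have := ltn_ord k; rewrite leq_eqVlt => /predU1P[->|kn]; last exact: (LS (Ordinal kn)).
    (* The power [n'.+1] lies outside the range of [LS]; Cayley-Hamilton brings it back. *)
    rewrite expr_size_cayley_hamilton mulNmx mulmxN mulmx_suml mulmx_sumr.
    by rewrite big1 ?oppr0 // => l _; rewrite -scalemxAl -scalemxAr LS scaler0.
  have [||lam [v v0 [vL vA]]] :=
      @stable_eigenvector _ _ _ (map_mx f A) (map_mx f L).
  - by rewrite -map_mxM map_submx.
  - by rewrite map_mx_eq0.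
  move/negP: v0; apply; apply/eqP; apply: (hautus lam) => //.
  have [D ->] := submxP vL; have := LS ord0; rewrite expr0 mul1mx => LB.
  by rewrite -mulmxA -map_mxM LB map_mx0 mulmx0.
have /sub_sumsmxP[u zE] : (z^T <= \sum_(k < n'.+1) <<(A ^+ k *m B)^T>>)%MS.
  by rewrite submx_full.
have /all_sig[w wE] k : {w | u k *m <<(A ^+ k *m B)^T>>%MS = w *m (A ^+ k *m B)^T}.
  exists (u k *m <<(A ^+ k *m B)^T>>%MS *m pinvmx (A ^+ k *m B)^T).
  by rewrite mulmxKpV // (submx_trans (submxMl _ _)) ?genmxE.
exists (fun k => if insub k is Some i then (w i)^T else 0).
apply: trmx_inj; rewrite zE raddf_sum; apply: eq_bigr => k _.
by rewrite valK /= wE [RHS]trmx_mul trmxK.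
Qed.

(** * A controllable realization *)

(* [hd i] is a chosen vertex of the cycle of [i], and [(hd i).+1] the weight of
   this cycle.  A head [j] is entered by the tree edge from [par j], or by the
   input [inp j] if it has no parent.  [eigen] and [unseen] say that [v] is a left
   eigenvector of this realization that is killed by its input matrix. *)
Section CycleForest.
Variables (n : nat) (sigma : {perm 'I_n}) (hd : 'I_n -> 'I_n) (lv : 'I_n -> nat).
Variables (I : eqType) (par : 'I_n -> option 'I_n) (inp : 'I_n -> option I).
Hypothesis hd_porbit : forall i, hd i \in porbit sigma i.
Hypothesis hd_eq : forall i j, (hd i == hd j) = (porbit sigma i == porbit sigma j).
Hypothesis lv_par : forall j t, hd j = j -> par j = Some t -> (lv (hd t) < lv j)%N.
Hypothesis inp_root : forall j, hd j = j -> par j = None -> inp j != None.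

Variables (C : numFieldType) (lam : C) (v : 'I_n -> C).
Hypothesis eigen : forall i, lam * v i =
  (hd i).+1%:R * v (sigma i) + \sum_(j | (hd j == j) && (par j == Some i)) v j.
Hypothesis unseen : forall m,
  \sum_(j | [&& hd j == j, par j == None & inp j == Some m]) v j = 0.

Let child i := \sum_(j | (hd j == j) && (par j == Some i)) v j.

Let hd_perm i m : hd ((sigma ^+ m)%g i) = hd i.
Proof. by apply/eqP; rewrite hd_eq porbit_perm. Qed.

Let hdK i : hd (hd i) = hd i.
Proof. by apply/eqP; rewrite hd_eq eq_porbit_mem hd_porbit. Qed.

Let same_orbit i j : hd i = hd j -> exists m, j = (sigma ^+ m)%g i.
Proof.
by move/eqP; rewrite hd_eq eq_sym eq_porbit_mem => /porbitP[m ->]; exists m.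
Qed.

(** This solves the recurrence [eigen] along [m] steps of a cycle; the sum collects what the
    children attached to the visited vertices contribute. *)
Let eigen_iter i m : lam ^+ m * v i = (hd i).+1%:R ^+ m * v ((sigma ^+ m)%g i) +
  \sum_(l < m) lam ^+ (m - l.+1) * (hd i).+1%:R ^+ l * child ((sigma ^+ l)%g i).
Proof.
elim: m => [|m IHm]; first by rewrite !expr0 expg0 perm1 big_ord0 addr0.
rewrite exprS -mulrA IHm mulrDr mulrCA eigen hd_perm big_ord_recr /= subnn expr0.
rewrite mul1r -/(child _) expgSr permM mulrDr exprSr -!mulrA -!addrA; congr (_ + _).
rewrite addrC; congr (_ + _); rewrite mulr_sumr; apply: eq_bigr => l _.
by rewrite subSn // exprS -!mulrA.
Qed.

Let mu_neq0 (i : 'I_n) : (i.+1%:R : C) != 0.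
Proof. by rewrite pnatr_eq0. Qed.

(* A cycle on which [v] does not vanish and which receives nothing from its
   children has the eigenvalue [lam] up to a root of unity; as the weights of
   distinct cycles differ, there is only one such cycle. *)
Let childless_weight i : v i != 0 -> (forall k, hd k = hd i -> child k = 0) ->
  lam ^+ #[sigma]%g = (hd i).+1%:R ^+ #[sigma]%g.
Proof.
move=> vi nochild; have := eigen_iter i #[sigma]%g.
rewrite expg_order perm1 big1 => [|l _]; last by rewrite nochild ?mulr0 ?hd_perm.
by rewrite addr0 => /(mulIf vi).
Qed.

(** A root is its own parent, so that the ancestors of a head form the orbit of a function. *)
Let pa j := odflt j (omap hd (par j)).

Lemma cycle_forest_observable : forall i, v i = 0.
Proof.
move=> i1; apply/eqP/negPn/negP => vi1.
case: (@arg_maxnP _ i1 (fun i => v i != 0) (fun i => lv (hd i)) vi1) => i0 vi0 i0max.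
have child0 k : hd k = hd i0 -> child k = 0.
  move=> hk; apply: big1 => j /andP[/eqP hj /eqP pj]; apply/eqP/negPn/negP => vj.
  have := i0max j vj; rewrite /= hj leqNgt -hk.
  by rewrite (lv_par hj pj).
have lamN := childless_weight vi0 child0.
have N0 : (0 < #[sigma]%g)%N by rewrite order_gt0.
have lam0 : lam != 0.
  apply/eqP => lam0; move/eqP: lamN; rewrite lam0 expr0n gtn_eqF // eq_sym.
  by rewrite expf_eq0 N0 /= (negbTE (mu_neq0 _)).
(* As long as some child sum on the cycle of [i] is nonzero, descend to a child where [v] does not
   vanish; depth is bounded by that of [i0]. Where all child sums vanish, the weight equals that of
   [i0], since positive numbers with equal powers are equal. *)
have mem_chain i : v i != 0 -> fconnect pa (hd i0) (hd i).
  have [b] := ubnP (lv (hd i0) - lv (hd i)).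
  elim: b i => // b IHb i ltb vi.
  have [/forallP nochild|] := boolP [forall k, (hd k == hd i) ==> (child k == 0)].
    suff -> : hd i = hd i0 by exact: connect0.
    have := childless_weight vi (fun k hk =>
      eqP (implyP (nochild k) (introT eqP hk))).
    rewrite lamN => /eqP; rewrite eqrXn2 ?ler0n // eqr_nat eqSS => /eqP H.
    exact/val_inj.
  rewrite negb_forall => /existsP[k]; rewrite negb_imply => /andP[/eqP hk ck].
  have [j /andP[/andP[/eqP hj /eqP pj] vj]] :
      exists j, (hd j == j) && (par j == Some k) && (v j != 0).
    apply/existsP; apply: contraNT ck; rewrite negb_exists => /forallP nz.
    by rewrite /child big1 // => j jP; have := nz j; rewrite jP /= negbK => /eqP.
  have lvj : (lv (hd i) < lv (hd j))%N by rewrite -hk hj; apply: lv_par.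
  have := i0max j vj; rewrite /= => lvj0.
  apply: connect_trans (IHb j _ vj) _; first by lia.
  by rewrite hj -hk; apply/connect1/eqP; rewrite /pa pj.
have lv_iter m j : hd j = j -> (lv (iter m pa j) <= lv j)%N /\ hd (iter m pa j) = iter m pa j.
  move=> hj; elim: m => [|m [IHm IHh]] //=; set k := iter m pa j in IHm IHh *.
  rewrite /pa; case E: (par k) => [t|] //=; rewrite hdK; split=> //.
  exact: leq_trans (ltnW (lv_par IHh E)) IHm.
(* Ancestors of [hd i0] form a chain along which [lv] decreases, so it contains
   at most one child of a given cycle. *)
have uniq_child j1 j2 : hd j1 = j1 -> hd j2 = j2 -> v j1 != 0 -> v j2 != 0 ->
    omap hd (par j1) = omap hd (par j2) -> j1 = j2.
  move=> h1 h2 v1 v2 par12.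
  have := mem_chain _ v1; have := mem_chain _ v2; rewrite h1 h2.
  move=> /iter_findex e2 /iter_findex e1.
  have chain (a b : nat) i j : (a <= b)%N -> hd i = i -> hd j = j ->
      iter a pa (hd i0) = i -> iter b pa (hd i0) = j ->
      omap hd (par i) = omap hd (par j) -> i = j.
    move=> ab hi hj ei ej epar; move: ej; rewrite -(subnK ab) iterD ei.
    case: (b - a)%N => [|c] //; rewrite iterSr.
    case pj : (par j) epar => [t|] /= epar.
      rewrite {2}/pa epar /= => ej; have := lv_par hj pj.
      by have [] := lv_iter c (hd t) (hdK t); rewrite ej leqNgt => /negbTE->.
    have pi : pa i = i by rewrite /pa epar.
    by rewrite pi => <-; elim: c => //= c <-.
  case/orP: (leq_total (findex pa (hd i0) j1) (findex pa (hd i0) j2)) => le.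
    exact: chain le h1 h2 e1 e2 _.
  by apply/esym; apply: chain le h2 h1 e2 e1 _.
(* Going from [i0] to its head without any child contribution, a zero at the head would make [v i0]
   vanish. *)
have vh0 : v (hd i0) != 0.
  have [m hm] := same_orbit (esym (hdK i0)).
  apply: contraNneq vi0 => vh0; have := eigen_iter i0 m.
  rewrite -hm vh0 mulr0 big1 ?addr0 => [/eqP|l _].
    by rewrite mulf_eq0 expf_eq0 (negbTE lam0) andbF.
  by rewrite child0 ?mulr0 ?hd_perm.
have climb j t : hd j = j -> par j = Some t -> v j != 0 -> v (hd t) != 0.
  move=> hj pj vj.
  (* By [uniq_child], [j] is the only child of the whole parent cycle on which [v] does not
     vanish. *)
  have childE k : hd k = hd t -> child k = if k == t then v j else 0.
    move=> hk; case: eqP => [->|kt].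
      rewrite /child (bigD1 j) /=; last by rewrite hj pj !eqxx.
      rewrite big1 ?addr0 // => j' /andP[/andP[/eqP hj' /eqP pj'] jj'].
      apply: contraNeq jj' => vj'; apply/eqP/uniq_child => //.
      by rewrite pj pj'.
    apply: big1 => j' /andP[/eqP hj' /eqP pj'].
    apply/eqP; apply: contra_notT kt => vj'.
    have : j' = j by apply: uniq_child => //; rewrite // pj pj' /= hk.
    by move=> e; move: pj'; rewrite e pj => -[].
  (* Once around the parent cycle, starting and ending where [v] vanishes, the
     child contributes exactly one term, which is nonzero. *)
  apply/negP => /eqP vt; set L := #|porbit sigma (hd t)|.
  have := eigen_iter (hd t) L.
  rewrite permX iter_porbit vt !mulr0 add0r.
  have tO : t \in traject sigma (hd t) L.
    by rewrite -porbit_traject -eq_porbit_mem -hd_eq hdK.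
  have [l lL tE] := trajectP tO.
  rewrite (bigD1 (Ordinal lL)) //= big1 ?addr0 => [|k kl]; last first.
    rewrite childE ?hd_perm ?hdK //; case: eqP => [E|]; last by rewrite mulr0.
    case/negP: kl; apply/eqP/val_inj => /=.
    have /(nth_uniq (hd t)) := uniq_traject_porbit sigma (hd t).
    rewrite size_traject => U; apply/eqP; rewrite -U -/L //.
    by rewrite !nth_traject // -tE -permX E.
  rewrite childE ?hd_perm ?hdK // permX -tE eqxx => /esym/eqP.
  by rewrite !mulf_eq0 !expf_eq0 (negbTE lam0) (negbTE (mu_neq0 _)) !andbF (negbTE vj).
(* Among the heads where [v] does not vanish, one of least depth has no parent, by [climb]. It is
   the only such root, so it is the only nonzero term in the sum of [unseen]. *)
have P0 : (hd (hd i0) == hd i0) && (v (hd i0) != 0) by rewrite hdK eqxx.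
case: (@arg_minnP _ (hd i0) (fun j => (hd j == j) && (v j != 0)) lv P0).
move=> j /andP[/eqP hj vj] jmin.
case pj : (par j) => [t|].
  have := jmin (hd t); rewrite hdK eqxx (climb _ _ hj pj vj) => /(_ isT).
  by rewrite leqNgt (lv_par hj pj).
case mj : (inp j) (inp_root hj pj) => [m|] // _.
have := unseen m; rewrite (bigD1 j) /= ?hj ?pj ?mj ?eqxx //.
rewrite big1 ?addr0 => [/eqP|j' /andP[/and3P[/eqP hj' /eqP pj' _] jj']].
  by rewrite (negbTE vj).
apply: contraNeq jj' => vj'.
by apply/eqP/uniq_child => //; rewrite pj pj'.
Qed.
End CycleForest.

(** The Kalman argument is set in positive dimension; the empty state space is treated apart. *)
Lemma controllable_dim0 (R : realType) (m : nat) (A : 'M[R]_0) (B : 'M[R]_(0, m)) :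
  controllable A B.
Proof.
move=> x0 x1; exists 1; split => //; exists (fun=> 0), (fun=> x0); split.
- exact/continuous_subspaceT/cst_continuous.
- exact/continuous_subspaceT/cst_continuous.
- move=> t _; rewrite [X in is_derive _ _ _ X]flatmx0.
  by rewrite -[X in is_derive _ _ _ X](flatmx0 0); exact: is_derive_cst.
- by [].
- by rewrite [x0]flatmx0 [x1]flatmx0.
Qed.

(* [layer_le k i]: the cycle of [i] is at depth less than [k] in a breadth-first
   search of the cycles of [sigma] from the vertices in [touched]. *)
Fixpoint layer_le (T : finType) (e : rel T) (touched : pred T) (sigma : {perm T})
    (k : nat) (i : T) : bool :=
  if k is k'.+1 then [exists h in porbit sigma i,
    touched h || [exists t, layer_le e touched sigma k' t && e t h]]
  else false.

Section CycleLayers.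
Variables (T : finType) (e : rel T) (touched : pred T) (sigma : {perm T}).
Hypothesis reached : forall i, exists2 r, touched r & connect e r i.
Local Notation layer := (layer_le e touched sigma).

Lemma layer_le_porbit k i j : porbit sigma i = porbit sigma j -> layer k i = layer k j.
Proof. by case: k => //= k ->. Qed.

Lemma layer_le_ex i : exists k, layer k i.
Proof.
have [r tr /connectP[p + ->]] := reached i.
have : layer 1 r.
  by apply/exists_inP; exists r; rewrite ?porbit_id // tr.
elim: p r {tr} 1%N => [|x p IHp] r k lr /=; first by exists k.
case/andP=> erx; apply: (IHp _ k.+1).
apply/exists_inP; exists x; first exact: porbit_id.
by apply/orP; right; apply/existsP; exists r; apply/andP.
Qed.

(** Let [lv] be the least layer containing the cycle. The vertex that puts the cycle in this layer
    is touched or has an edge from an earlier layer. *)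
Lemma cycle_layers : exists lv : T -> nat,
  (forall i j, porbit sigma i = porbit sigma j -> lv i = lv j) /\
  forall i, exists2 h, h \in porbit sigma i &
    touched h || [exists t, (lv t < lv h)%N && e t h].
Proof.
pose lv i := ex_minn (layer_le_ex i).
have lv_porbit i j : porbit sigma i = porbit sigma j -> lv i = lv j.
  move=> ij; rewrite /lv; case: ex_minnP => a la mina; case: ex_minnP => b lb minb.
  apply/eqP; rewrite eqn_leq mina ?minb //; first by rewrite -(layer_le_porbit _ ij).
  by rewrite (layer_le_porbit _ ij).
exists lv; split=> // i.
have : layer (lv i) i by rewrite /lv; case: ex_minnP.
have [k] : exists k, k = lv i by exists (lv i).
move=> /[dup] ki <-; case: k ki => //= k ki /exists_inP[h hi].
case/orP=> [th|/existsP[t /andP[lt eth]]]; exists h; rewrite ?th //.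
apply/orP; right; apply/existsP; exists t; rewrite eth andbT.
have /lv_porbit -> : porbit sigma h = porbit sigma i by apply/eqP; rewrite eq_porbit_mem.
by rewrite -ki ltnS {1}/lv; case: ex_minnP => b _; apply.
Qed.

End CycleLayers.

Lemma reached_structurally_controllable (R : realType) (C : numClosedFieldType)
    (f : {rmorphism R -> C}) (n m : nat)
    (A : smatrix n n) (B : smatrix n m) (sigma : {perm 'I_n}) :
  (forall i, state_edge A i (sigma i)) ->
  (forall i, exists2 r, [exists j, B r j] & connect (state_edge A) r i) ->
  structurally_controllable R A B.
Proof.
case: n A B sigma => [|n'] A B sigma sigma_edge reached.
  by exists 0, 0; split; [move=> i j; rewrite mxE..|exact: controllable_dim0].
have [lv [lv_porbit headP]] := @cycle_layers _ _ (fun r => [exists j, B r j]) sigma reached.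
pose head_of h := [exists j, B h j] ||
  [exists t, (lv t < lv h)%N && state_edge A t h].
(* By [headP] the default is never taken, and the choice depends only on the orbit of [i]. *)
pose hd i := odflt i [pick h in porbit sigma i | head_of h].
have hdP i : hd i \in porbit sigma i /\ head_of (hd i).
  rewrite /hd; case: pickP => [h /andP[]//|no] /=.
  by have [h hi hh] := headP i; have := no h; rewrite hi /head_of hh.
have hd_eq i j : (hd i == hd j) = (porbit sigma i == porbit sigma j).
  apply/eqP/eqP => [hij|ij].
    have [hi _] := hdP i; have [hj _] := hdP j.
    move: hi hj; rewrite -!eq_porbit_mem hij => /eqP <- /eqP <- //.
  have [+ _] := hdP i; have [+ _] := hdP j; rewrite /hd ij.
  case: pickP => // no; have [h hj hh] := headP j.
  by have := no h; rewrite hj /head_of hh.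
pose par h := if [exists j, B h j] then None else
  [pick t | (lv t < lv h)%N && state_edge A t h].
pose inp h := [pick j | B h j].
(* Entry (i, j) weighs the edge from j to i, so that component j of a left eigenvector equation is
   the relation [eigen] at j. *)
pose Amx : 'M[R]_n'.+1 := \matrix_(i, j)
  (((hd j).+1%:R *+ (i == sigma j)) + ((hd i == i) && (par i == Some j))%:R).
pose Bmx : 'M[R]_(n'.+1, m) := \matrix_(i, j)
  [&& hd i == i, par i == None & inp i == Some j]%:R.
exists Amx, Bmx; split.
- move=> i j Aij; rewrite mxE; case: eqP => [ij|_].
    by have := sigma_edge j; rewrite /state_edge -ij Aij.
  rewrite mulr0n add0r; case: eqP => //= _; case: eqP => //; rewrite /par.
  case: ifP => // _; case: pickP => // t /andP[_ et] [tj].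
  by move: et; rewrite tj /state_edge Aij.
- move=> i j Bij; rewrite mxE; case: eqP => //= _; case: eqP => //= _; case: eqP => //.
  by rewrite /inp; case: pickP => // t + [tj]; rewrite tj Bij.
have lv_hd i : lv (hd i) = lv i.
  by apply/lv_porbit/eqP; rewrite eq_porbit_mem; have [] := hdP i.
apply/kalman_controllable/(hautus_kalman (f := f)) => lam v vA vB.
apply/rowP => i; rewrite mxE.
apply: (@cycle_forest_observable _ sigma hd lv _ par inp _ hd_eq _ _ _ lam)
  => [{}i|j t hj|j hj|{}i|k].
- by have [] := hdP i.
- rewrite lv_hd /par; case: ifP => // _.
  by case: pickP => // t' /andP[+ _] [<-].
- have [_] := hdP j; rewrite hj /head_of => Hj Pj.
  have /existsP[k jk] : [exists k, B j k].
    move: Pj; rewrite /par; case: ifP Hj => // _ /existsP[t tj].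
    by case: pickP => // no; have := no t; rewrite tj.
  by rewrite /inp; case: pickP => // no; have := no k; rewrite jk.
- move/rowP: vA => /(_ i); rewrite !mxE => <-.
  under eq_bigr do rewrite !mxE rmorphD rmorphMn /= !rmorph_nat mulrDr.
  rewrite big_split /=; congr (_ + _).
    rewrite (bigD1 (sigma i)) //= eqxx mulr1n mulrC big1 ?addr0 // => j /negbTE ->.
    by rewrite mulr0n mulr0.
  by under eq_bigr do rewrite mulr_natr mulrb; rewrite -big_mkcond.
- move/rowP: vB => /(_ k); rewrite !mxE => vBk; rewrite -[RHS]vBk.
  by under [RHS]eq_bigr do rewrite !mxE rmorph_nat mulr_natr mulrb; rewrite -big_mkcond.
Qed.

(** * Uncontrollability without a cover *)

(** The squared norm [g] satisfies g' <= K g, because |y_i| |y_j| <= g. So g exp(-K t) does not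
    increase, and it starts from 0. *)
Lemma linear_ode_zero (R : realType) (n : nat) (M : 'M[R]_n) (y : 'I_n -> R -> R)
    (T : R) :
  0 < T -> (forall i, {within `[0, T], continuous (y i)}) ->
  (forall i t, 0 < t < T -> is_derive t 1 (y i) (\sum_j M i j * y j t)) ->
  (forall i, y i 0 = 0) -> forall i, y i T = 0.
Proof.
move=> T0 cy dy y0.
pose K := \sum_i \sum_j 2 * `|M i j|.
pose g : R -> R := \sum_(i < n) (y i) ^+ 2.
pose E : R -> R := expR \o ( *%R (- K)).
have gE t : g t = \sum_i y i t ^+ 2.
  by rewrite /g fct_sumE; apply: eq_bigr => i _; rewrite exprfctE.
have yg i t : y i t ^+ 2 <= g t.
  by rewrite gE (bigD1 i) //= lerDl sumr_ge0 // => j _; rewrite sqr_ge0.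
have dE (t : R) : is_derive t 1 E (E t * (- K * 1)).
  apply: is_derive1_comp; exact: (@is_deriveZ _ _ id).

have df (t : R) : 0 < t < T -> exists2 d, d <= 0 & is_derive t 1 (g * E) d.
  move=> tT; have dyt i := dy i t tT.
  have dg : is_derive t 1 g (\sum_i (2%:R * y i t ^+ 1) *: (\sum_j M i j * y j t)).
    by apply: is_derive_sum => i; apply: is_deriveX.
  eexists; last exact: is_deriveM.
  set S := \sum_i _.
  have -> : g t *: (E t * (- K * 1)) + E t *: S = E t * (S - K * g t).
    by rewrite /GRing.scale /=; ring.
  rewrite pmulr_rle0 ?expR_gt0 // subr_le0 /K mulr_suml.
  apply: ler_sum => i _; rewrite expr1 scaler_sumr mulr_suml.
  apply: ler_sum => j _; apply: le_trans (ler_norm _) _.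
  rewrite -[_ *: _]/(_ * _) !normrM ger0_norm //.
  have -> : 2 * `|y i t| * (`|M i j| * `|y j t|) =
    2 * `|M i j| * (`|y i t| * `|y j t|) by ring.
  apply: ler_wpM2l; first by rewrite mulr_ge0.
  have := yg i t; have := yg j t; rewrite -(real_normK (num_real (y i t))).
  rewrite -(real_normK (num_real (y j t))).
  by have := sqr_ge0 (`|y i t| - `|y j t|); rewrite sqrrB; nra.
have cg : {within `[0, T], continuous g}.
  rewrite /g; elim/big_ind : _ => [|h1 h2 c1 c2|i _].
    exact/continuous_subspaceT/cst_continuous.
    exact: within_continuousD.
  by rewrite expr2 => x; apply: cvgM; exact: cy.
have cE : continuous E.
  move=> t; apply: differentiable_continuous; apply/derivable1_diffP.
  by have [] := dE t.
have cf : {within `[0, T], continuous (g * E)}.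
  by move=> x; apply: cvgM; [exact: cg|exact: (continuous_subspaceT cE)].
have gT : g T <= 0.
  have := @ler0_derive1_le_cc _ (g * E) 0 T _ _ cf T 0.
  rewrite !in_itv /= !lexx (ltW T0) /= => mono.
  have : (g * E) T <= (g * E) 0.
    apply: mono => // x; rewrite in_itv => /df[d d0 [ ]] // dx.
    by rewrite derive1E => ->.
  rewrite -![(g * E) _]/(g _ * E _) [g 0]gE big1 ?mul0r => [|i _].
    by rewrite pmulr_lle0 // expR_gt0.
  by rewrite y0 expr0n.
move=> i; apply/eqP; rewrite -sqrf_eq0 eq_le sqr_ge0 andbT.
exact: le_trans (yg i T) gT.
Qed.

(** The states in [N] depend on neither the input nor the other states; starting from 0 they stay at
    0 and never reach the all-ones target. *)
Lemma controllable_no_autonomous_part (R : realType) (n m : nat)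
    (A : 'M[R]_n) (B : 'M[R]_(n, m)) (N : {set 'I_n}) :
  controllable A B ->
  (forall i j, i \in N -> j \notin N -> A i j = 0) ->
  (forall i j, i \in N -> B i j = 0) -> N = finset.set0.
Proof.
move=> ctrl AN BN; apply/eqP; apply: contraT => /set0Pn[i0 i0N].
have [T [T0 [u [x [_ cx dx x0 xT]]]]] := ctrl 0 (const_mx 1).
(* Extending by 0 outside [N] keeps the full index type ['I_n]. *)
pose y i t := if i \in N then x t i 0 else 0 : R.
pose M := \matrix_(i, j) if (i \in N) && (j \in N) then A i j else 0.
have := @linear_ode_zero R n M y T T0 _ _ _ i0.
rewrite /y i0N xT mxE => /(_ _ _ _)/eqP; rewrite oner_eq0; apply.
- move=> i; case: (i \in N); last exact/continuous_subspaceT/cst_continuous.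
  apply: (@within_continuous_comp _ _ _ _ x (fun z : 'cV[R]_n => z i 0)) => // z _.
  exact: coord_continuous.
- move=> i t tT; have [xt xtE] := dx t tT.
  have [iN|iN] := boolP (i \in N); last first.
    rewrite big1 => [|j _]; first exact: is_derive_cst.
    by rewrite mxE (negbTE iN) mul0r.
  have dxi := (derivable_mxP _ _ _).1 xt i 0.
  apply: DeriveDef => //; move/matrixP: xtE => /(_ i 0).
  rewrite derive_mx // mxE => ->; rewrite !mxE [X in _ + X]big1 ?addr0; last first.
    by move=> j _; rewrite BN ?mul0r.
  apply: eq_bigr => j _; rewrite mxE iN /=; case: (boolP (j \in N)) => // jN.
  by rewrite AN // !mul0r.
- by move=> i; case: ifP => // _; rewrite x0 mxE.
Qed.

Lemma perfect_matching_perm (n : nat) (A : smatrix n n) :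
  has_perfect_matching A -> exists sigma : {perm 'I_n}, forall i, state_edge A i (sigma i).
Proof.
case=> M [[Medge _ Minj] Mleft _].
have /choice[f fP] : forall i, exists e, e \in M /\ e.1 = i.
  by move=> i; have [e eM ei] := Mleft i; exists e.
have finj : injective (fun i => (f i).2).
  move=> i j ij; have [iM <-] := fP i; have [jM <-] := fP j.
  by rewrite (Minj _ _ iM jM ij).
exists (perm finj) => i; rewrite permE.
by have [iM {1}<-] := fP i; exact: Medge.
Qed.

(** * Covers and structural controllability *)

(** Every state has an ancestor in a non-top linked component, and a chosen column touches some
    vertex of this component, from which the state is then reached. *)
Lemma cover_structurally_controllable (R : realType) (n p k : nat)
    (A : smatrix n n) (B : smatrix n p) (N : 'I_k -> {set 'I_n}) (J : {set 'I_p}) :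
  has_perfect_matching A -> non_top_linked_sccs A N ->
  (\bigcup_(j in J) cover_sets B N j)%SET = [set: 'I_k]%SET ->
  structurally_controllable R A (subcolumns B J).
Proof.
move=> /perfect_matching_perm[sigma sigmaP] [_ NP] cover.
apply: (reached_structurally_controllable (real_complex R) sigmaP) => v.
have [u utop uv] := non_top_linked_ancestor A v.
have [i iE] : exists i, N i = scc A u by apply/NP; split => //; apply/sccsP; exists u.
have : i \in (\bigcup_(j in J) cover_sets B N j)%SET by rewrite cover inE.
case/bigcupP => j jJ; rewrite inE => /existsP[r /andP[]].
rewrite iE inE => /andP[_ ru] Brj; exists r; last exact: connect_trans ru uv.
by apply/existsP; exists (enum_rank_in jJ j); rewrite mxE enum_rankK_in.
Qed.

(** A non-top linked component missed by all chosen columns receives neither an edge from outside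
    nor an input, so it is an autonomous part. *)
Lemma structurally_controllable_cover (R : realType) (n p k : nat)
    (A : smatrix n n) (B : smatrix n p) (N : 'I_k -> {set 'I_n}) (J : {set 'I_p}) :
  non_top_linked_sccs A N -> structurally_controllable R A (subcolumns B J) ->
  (\bigcup_(j in J) cover_sets B N j)%SET = [set: 'I_k]%SET.
Proof.
move=> [_ NP] [A' [B' [rA rB ctrl]]]; apply/setP => i; rewrite inE.
apply/contraT => /bigcupP nocover.
have [/sccsP[v NE] ntl] : N i \in sccs A /\ non_top_linked A (N i) by apply/NP; exists i.
suff N0 : N i = finset.set0 by have := mem_scc A v; rewrite -NE N0 inE.
apply: (controllable_no_autonomous_part ctrl) => [a b aN bN|a b aN].
  apply: rA; apply/negbTE.
  apply: (ntl (scc A b)) (mem_scc A b) aN; first by apply/sccsP; exists b.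
  by apply: contraNneq bN => <-; exact: mem_scc.
apply: rB; rewrite mxE; apply/negbTE/negP => Bab; apply: nocover.
by exists (enum_val b); rewrite ?enum_valP // inE; apply/existsP; exists a; rewrite aN.
Qed.

Lemma min_set_cover_minCIS (R : realType) (n p k : nat)
    (A : smatrix n n) (B : smatrix n p) (N : 'I_k -> {set 'I_n}) (J : {set 'I_p}) :
  has_perfect_matching A -> non_top_linked_sccs A N ->
  min_set_cover_solution (cover_sets B N) J -> minCIS_solution R A B J.
Proof.
move=> pm NP [cover Jmin]; split; first exact: cover_structurally_controllable cover.
by move=> J' /(structurally_controllable_cover NP)/Jmin.
Qed.

Local Open Scope nat_scope.

Theorem theorem3 :
  exists (c : cmd) (q : {poly nat}),
    forall (n p : nat) (A : smatrix n n) (B : smatrix n p),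
      has_perfect_matching A ->
      (exists (k : nat) (N : 'I_k -> {set 'I_n}),
          non_top_linked_sccs A N /\
          computes_within c (q.[input_size n p])%R A B (cover_sets B N)) /\
      (forall (R : realType) (k : nat) (N : 'I_k -> {set 'I_n}),
          non_top_linked_sccs A N ->
          forall J : {set 'I_p},
            min_set_cover_solution (cover_sets B N) J ->
            minCIS_solution R A B J).
Proof.
(* The program has four passes, each within [time_bound 1000], and [time_bound] is at most quadratic
   in the input size. *)
exists reduction_cmd, (4000%N%:P * (('X + 1) * ('X + 1)))%R => n p A B pm; split; last first.
  by move=> R k N NP J; apply: min_set_cover_minCIS.
exists _, (@kept_scc n A); split; first exact: kept_sccs.
have [t [s' [et tb os]]] := reduction_computes A B.
exists t, s'; split=> //; apply: leq_trans tb _.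
apply: leq_trans (time_bound_input_size _ _ _) _.
rewrite !(hornerM, hornerD, hornerX, hornerC).
by rewrite -[X in _ <= X]/(4000 * ((input_size n p + 1) * (input_size n p + 1))) addn1.
Qed.
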